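(* Let $p\in\{1,\infty\}$ and let $f:\mathbb{R}^n\to\mathbb{R}^n$ be real analytic and nonexpansive with respect to the $p$-norm, with $\operatorname{Fix}(f)\neq\varnothing$. Then there exists a positive integer $q$ such that: (i) for each $x\in\mathbb{R}^n$ the sequence $(f^{kq}(x))_{k\ge0}$ converges; (ii) the limit of $(f^{kq}(x))_k$ is a periodic point of $f$ whose minimal period divides $q$; (iii) there is a permutation $\pi$ of $\{1,\dots,n\}$ such that $q$ equals either the order of $\pi$ or twice the order of $\pi$.
   Context: $\|x\|_1=\sum_i|x_i|$ and $\|x\|_\infty=\max_i|x_i|$. $f$ is $p$-norm nonexpansive if $\|f(x)-f(y)\|_p\le\|x-y\|_p$ for all $x,y$. Real analytic means each component of $f$ is a real analytic function. $f^k$ is the $k$-fold composition. A point $x$ is periodic if its orbit $\{f^k(x):k\ge0\}$ is finite; its minimal period is the number of elements of its orbit. *)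

(* Defs.v *)
From HB Require Import structures.
From mathcomp Require Import all_boot all_order all_algebra all_fingroup.
From mathcomp Require Import all_classical all_reals all_analysis.
Set Implicit Arguments. Unset Strict Implicit. Unset Printing Implicit Defensive.
Import Order.TTheory GRing.Theory Num.Theory numFieldNormedType.Exports.
Local Open Scope classical_set_scope.
Local Open Scope ring_scope.

Inductive pnorm := P1 | Pinf.

Definition norm1 {R : realType} {n : nat} (x : 'I_n -> R) : R :=
  \sum_(i < n) `|x i|.

Definition norminf {R : realType} {n : nat} (x : 'I_n -> R) : R :=
  \big[Num.max/0]_(i < n) `|x i|.

Definition pnormv {R : realType} {n : nat} (p : pnorm) (x : 'I_n -> R) : R :=
  match p with P1 => norm1 x | Pinf => norminf x end.

Definition nonexpansive {R : realType} {n : nat} (p : pnorm)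
    (f : ('I_n -> R) -> ('I_n -> R)) : Prop :=
  forall x y, pnormv p (fun i => f x i - f y i) <= pnormv p (fun i => x i - y i).

(* g : R^n -> R is real analytic at a: on some neighbourhood of a, g is the sum
   of an absolutely convergent power series centred at a (indexed by
   multi-indices alpha : 'I_n -> nat).  Absolute convergence is expressed by
   boundedness of the partial sums of absolute values over the boxes
   {alpha | alpha i < N}, and the value by the limit of the box partial sums. *)
Definition analytic_at {R : realType} {n : nat} (g : ('I_n -> R) -> R)
    (a : 'I_n -> R) : Prop :=
  exists r : R, 0 < r /\
  exists c : ('I_n -> nat) -> R,
  forall x : 'I_n -> R, (forall i, `|x i - a i| < r) ->
    let t := fun alpha : 'I_n -> nat =>
               c alpha * \prod_(i < n) (x i - a i) ^+ (alpha i) in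
    (exists M : R, forall N : nat,
        \sum_(alpha : {ffun 'I_n -> 'I_N}) `|t (fun i => nat_of_ord (alpha i))| <= M)
    /\ (fun N : nat => \sum_(alpha : {ffun 'I_n -> 'I_N})
                         t (fun i => nat_of_ord (alpha i))) @ \oo --> (g x : R).

Definition real_analytic_fun {R : realType} {n : nat} (g : ('I_n -> R) -> R) : Prop :=
  forall a, analytic_at g a.

Definition real_analytic {R : realType} {n : nat}
    (f : ('I_n -> R) -> ('I_n -> R)) : Prop :=
  forall i : 'I_n, real_analytic_fun (fun x => f x i).

Definition orbit_set {T : Type} (f : T -> T) (x : T) : set T :=
  [set iter k f x | k in [set: nat]].

Definition periodic_with_min_period {T : Type} (f : T -> T) (x : T) (m : nat) : Prop :=
  (orbit_set f x #= `I_m)%card.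

(* Main.v *)
(** A fixed point is moved to 0. Let [Om] be the set of recurrent points, on which f
    is a bijective isometry; the functionals [ev v] (signed coordinates, or signed
    sums of coordinates) are those with [N x = max_v ev v x].
    If x, y are in [Om] and [ev v] norms f(x) - f(y), then [ev v \o f] has slope
    norm(x - y) on the segment [x,y], hence, by analyticity, on the whole line; the
    two Busemann functions of the line then bound [ev v \o f] on all of R^n by the
    extreme values of the functionals norming x - y. Two such bounds can be
    intersected, again by analyticity, so each [ev v \o f] has a smallest face of
    controlling functionals. It follows that f permutes the maximal cones
    [{x in Om | ev v x = N x}], that the functionals defining the same cone agree on
    [Om], and that they determine the metric of [Om]: f acts on [Om] linearly in
    these coordinates, with finite order.
    For the sup norm the maximal functionals are coordinates up to sign, and f
    permutes their classes up to sign. For the 1-norm, the i-th coordinate, viewed as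
    a function on the linear space that parametrizes [Om], is constant on [Om] or
    monotone with level sets parallel to a hyperplane [hyp i]; these at most n
    hyperplanes form the locus where the norm is not smooth, so f permutes them. In
    both cases twice the order of a permutation of the coordinates is a period. *)
Require Import Defs.
From HB Require Import structures.
From mathcomp Require Import all_boot all_order all_algebra all_fingroup.
From mathcomp Require Import all_classical all_reals all_analysis.
From mathcomp Require Import zify lra ring.
Set Implicit Arguments. Unset Strict Implicit. Unset Printing Implicit Defensive.
Import Order.TTheory GRing.Theory Num.Theory numFieldNormedType.Exports.
Local Open Scope classical_set_scope.
Local Open Scope ring_scope.

(** * Finite orbits, permutations of classes, unions of subspaces, ultrafilter limits *)

Lemma iter_idem (T : finType) (h : T -> T) (v : T) :
  exists p, (0 < p)%N /\ iter p h (iter p h v) = iter p h v.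
Proof.
have [i [j [ij eij]]] : exists i j, (i < j)%N /\ iter i h v = iter j h v.
  pose g (i : 'I_(#|T|.+1)) := iter i h v.
  have /injectivePn[i [j ij gij]] : ~~ injectiveb g.
    apply/negP => /injectiveP /leq_card; rewrite card_ord ltnn //.
  case: (ltngtP i j) => [lt|lt|eq].
  - by exists i, j.
  - by exists j, i.
  - by move/eqP: ij; case; apply: val_inj.
have per k m : (i <= k)%N -> iter (k + m * (j - i)) h v = iter k h v.
  move=> ik; elim: m => [|m <-]; first by rewrite mul0n addn0.
  have -> : (k + m.+1 * (j - i) = (k + m * (j - i) - i) + j)%N.
    rewrite mulSn; move: (m * _)%N => c; lia.
  rewrite iterD -eij -iterD subnK //; lia.
(* This exponent is a multiple of the period [j - i] and exceeds the preperiod [i]. *)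
exists (j.+1 * (j - i))%N; split; first by rewrite muln_gt0 /= subn_gt0.
rewrite -iterD per //.
have : (0 < j - i)%N by rewrite subn_gt0.
nia.
Qed.

(** [rho] induces an injection on the finite set of classes of [eqv] in [E]. Choosing a
    representative [r i] of each class turns it into a permutation of representatives, extended by
    the identity, whose order returns every class to itself. *)
Lemma perm_of_classes (n : nat) (E : pred 'I_n) (eqv : 'I_n -> 'I_n -> Prop)
    (rho : 'I_n -> 'I_n) :
  (forall i, eqv i i) -> (forall i j, eqv i j -> eqv j i) ->
  (forall i j k, eqv i j -> eqv j k -> eqv i k) ->
  (forall i, E i -> E (rho i)) ->
  (forall i j, E i -> E j -> (eqv i j <-> eqv (rho i) (rho j))) ->
  exists pi : 'S_n, forall i, E i -> eqv (iter #[pi]%g rho i) i.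
Proof.
move=> eqr eqs eqt Erho eqrho.
pose Q i := [pred j | E j && `[< eqv i j >]].
pose r i := odflt i [pick j | Q i j].
have rP i : E i -> E (r i) /\ eqv i (r i).
  move=> Ei; rewrite /r; case: pickP => [j /andP[Ej /asboolP ij] //|/(_ i)].
  by rewrite /= Ei => /asboolP.
have req i j : E i -> eqv i j -> r i = r j.
  move=> Ei ij; rewrite /r; have QQ : Q i =1 Q j.
    move=> k /=; congr andb; apply/asboolP/asboolP => h; [|exact: eqt ij h].
    exact: eqt (eqs _ _ ij) h.
  rewrite (eq_pick QQ); case: pickP => // /(_ i).
  by rewrite /= Ei => /asboolP; case; apply: eqs.
have rr i : E i -> r (r i) = r i.
  by move=> Ei; have [Er ir] := rP i Ei; rewrite -(req i) // .
pose p i := if E i && (r i == i) then r (rho i) else i.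
have rep i : E i -> E (r (rho i)) && (r (r (rho i)) == r (rho i)).
  by move=> Ei; have Er := Erho i Ei; rewrite rr // eqxx (rP _ Er).1.
have pinj : injective p.
  move=> i j; rewrite /p; case: ifP => [/andP[Ei /eqP ri]|ni]; case: ifP => [/andP[Ej /eqP rj]|nj] //.
  - move=> h; rewrite -ri -rj; apply: req => //; apply/eqrho => //.
    have [_ a] := rP _ (Erho i Ei); have [_ b] := rP _ (Erho j Ej).
    by apply: eqt a _; rewrite h; apply: eqs.
  - by move=> h; move: nj; rewrite -h rep.
  - by move=> h; move: ni; rewrite h rep.
pose pi := perm pinj; exists pi.
have Eiter k i : E i -> E (iter k rho i) by move=> Ei; elim: k => //= k; apply: Erho.
have eqiter k i j : E i -> E j -> eqv i j -> eqv (iter k rho i) (iter k rho j).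
  by move=> Ei Ej ij; elim: k => //= k IH; apply: (eqrho _ _ (Eiter k i Ei) (Eiter k j Ej)).1.
have piter k i : E i -> r i = i -> iter k pi i = r (iter k rho i).
  move=> Ei ri; elim: k => //= k ->; rewrite permE /p.
  have Ek := Eiter k i Ei; have [Er kr] := rP _ Ek.
  rewrite Er rr // eqxx /=; apply/esym/req; first exact: Erho.
  exact: (eqrho _ _ Ek Er).1.
move=> i Ei; have [Er ir] := rP i Ei; set m := #[pi]%g.
have h : iter m pi (r i) = r i by rewrite -permX expg_order perm1.
rewrite piter ?rr // in h.
apply: (eqt _ _ _ (eqiter m _ _ Ei Er ir)); apply: (eqt _ (r i)); last exact: eqs.
by rewrite -[X in eqv _ X]h; have [] := rP _ (Eiter m _ Er).
Qed.

(** A real vector space is not a union of finitely many proper subspaces. If [a] lies outside the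
    first one and [b] outside all the others, then no [a + m%:R *: b] lies in the first, so two of
    these points share another one, which must contain [b]. *)
Lemma subspace_cover (R : realType) (X : lmodType R) (I : eqType)
    (W : X -> Prop) (Q : I -> X -> Prop) (s : seq I) :
  W 0 -> (forall a b, W a -> W b -> W (a + b)) -> (forall t a, W a -> W (t *: a)) ->
  (forall j a b, W a -> W b -> Q j a -> Q j b -> Q j (a + b)) ->
  (forall j t a, W a -> Q j a -> Q j (t *: a)) ->
  (forall d, W d -> exists2 j, j \in s & Q j d) ->
  exists2 j, j \in s & forall d, W d -> Q j d.
Proof.
move=> W0 WD WZ QD QZ; elim: s => [|j s IH] cov.
  by have [j] := cov 0 W0; rewrite in_nil.
have [all|/existsNP[a /not_implyP[Wa na]]] := pselect (forall d, W d -> Q j d).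
  by exists j; rewrite ?mem_head.
have [sub|/existsNP[b /not_implyP[Wb nb]]] :=
    pselect (forall d, W d -> exists2 j, j \in s & Q j d).
  by have [k ks H] := IH sub; exists k => //; rewrite in_cons ks orbT.
have Qb : Q j b.
  have [k] := cov b Wb; rewrite in_cons => /orP[/eqP -> //|ks kb].
  by case: nb; exists k.
have Wm m : W (a + m%:R *: b) by apply: WD => //; apply: WZ.
have /choice[g gP] : forall m : nat, exists k, k \in s /\ Q k (a + m%:R *: b).
  move=> m; have [k] := cov _ (Wm m).
  rewrite in_cons => /orP[/eqP -> h|ks kb]; last by exists k.
  case: na; have -> : a = (a + m%:R *: b) + (- m%:R) *: b by rewrite scaleNr addrK.
  by apply: QD => //; [exact: WZ|exact: QZ].
have ginj : {in iota 0 (size s).+1 &, injective g}.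
  move=> m m' _ _ gg; apply/eqP/negPn/negP => mm; case: nb; exists (g m); first by have [] := gP m.
  have c0 : m%:R - m'%:R != 0 :> R by rewrite subr_eq0 eqr_nat.
  have -> : b = (m%:R - m'%:R)^-1 *: ((a + m%:R *: b) + (-1) *: (a + m'%:R *: b)).
    by rewrite scaleN1r opprD addrACA subrr add0r -scalerBl scalerA mulVf // scale1r.
  have [_ q] := gP m; have [_ q'] := gP m'; rewrite -gg in q'.
  apply: (QZ); [apply: (WD) => //; exact: WZ|apply: (QD) => //; [exact: WZ|exact: QZ]].
have : uniq (map g (iota 0 (size s).+1)) by rewrite map_inj_in_uniq ?iota_uniq.
move=> /uniq_leq_size h; have := h s; rewrite size_map size_iota ltnn => /(_ _)/negP[] //.
by move=> _ /mapP[m _ ->]; have [] := gP m.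
Qed.

(** The limit is the supremum of the [c] with [c <= u j] for [U]-almost all [j]; the ultrafilter
    property gives the bound from above. *)
Lemma ultra_limit (R : realType) (U : set_system nat) (u : nat -> R) (C : R) :
  UltraFilter U -> (forall j, `|u j| <= C) ->
  exists l, forall eps, 0 < eps -> U [set j | `|u j - l| < eps].
Proof.
move=> UU uC; pose S := [set c | U [set j | c <= u j]].
have uC2 j : - C <= u j <= C by rewrite -ler_norml.
have S0 : S (- C).
  by apply: filterS filterT => j _ /=; case/andP: (uC2 j).
have ubS : ubound S C.
  move=> c /filter_ex[j /= cj]; apply: le_trans cj _; by case/andP: (uC2 j).
have hS : has_sup S by split; [exists (- C)|exists C].
exists (sup S) => eps e0.
have [c Sc lc] := sup_adherent e0 hS.
have : U [set j | u j < sup S + eps].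
  have [h|h] := in_ultra_setVsetC [set j | sup S + eps <= u j] UU.
    have : sup S + eps <= sup S by apply: ub_le_sup => //; exists C.
    by rewrite gerDl leNgt e0.
  by apply: filterS h => j /= /negP; rewrite -ltNge.
apply: filterS2 Sc => j /= h1 h2; rewrite ltr_norml; apply/andP; split; lra.
Qed.

(** * Polyhedral norms and lines of slope one *)

Lemma fin_eventually (R : realType) (V : finType) (Q : V -> R -> Prop) :
  (forall v, exists t0, forall t, t0 <= t -> Q v t) ->
  exists t0, 0 <= t0 /\ forall t, t0 <= t -> forall v, Q v t.
Proof.
move=> /choice[T QT]; exists (\big[Num.max/0]_v T v); split.
  by apply: bigmax_ge_id.
move=> t tle v; apply: QT; apply: le_trans tle.
exact: le_bigmax.
Qed.

Lemma fin_closed (R : realType) (V : finType) (A : {set V}) (g : V -> R) (a : R) :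
  (forall e, 0 < e -> exists2 v, v \in A & a <= g v + e) ->
  exists2 v, v \in A & a <= g v.
Proof.
move=> H; have [v0 v0A _] := H 1 ltr01.
case: (arg_maxP g v0A) => v vA vmax; exists v => //; rewrite leNgt; apply/negP => ga.
have [|w wA] := H ((a - g v) / 2); first by lra.
have := vmax w wA; rewrite /=; lra.
Qed.

Lemma affine_large (R : realType) (a b c : R) : 0 < c ->
  exists t0, forall t, t0 <= t -> a <= b + t * c.
Proof.
move=> c0; exists ((a - b) / c) => t; rewrite ler_pdivrMr //; lra.
Qed.

Section Polyhedral.
Variables (R : realType) (X : lmodType R) (V : finType).
Variables (ev : V -> {scalar X}) (neg : V -> V) (N : X -> R).
Hypothesis ev_le : forall v x, ev v x <= N x.
Hypothesis ev_attain : forall x, exists v, ev v x = N x.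
Hypothesis ev_neg : forall v x, ev (neg v) x = - ev v x.
Implicit Types (A B : {set V}) (x y z d w u : X) (v e : V).

Lemma evD v x y : ev v (x + y) = ev v x + ev v y. Proof. exact: linearD. Qed.
Lemma evB v x y : ev v (x - y) = ev v x - ev v y. Proof. exact: linearB. Qed.
Lemma evN v x : ev v (- x) = - ev v x. Proof. exact: linearN. Qed.
Lemma ev0 v : ev v 0 = 0. Proof. exact: linear0. Qed.
Lemma evZ v a x : ev v (a *: x) = a * ev v x. Proof. exact: scalarZ. Qed.
Definition evE := (evD, evB, evN, ev0, evZ).

Lemma ev_ge v x : - N x <= ev v x.
Proof. by rewrite lerNl -ev_neg ev_le. Qed.

Lemma ev_abs v x : `|ev v x| <= N x.
Proof. by rewrite ler_norml ev_ge ev_le. Qed.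

Lemma N_ge0 x : 0 <= N x.
Proof. have [v _] := ev_attain x; have := ev_le v x; have := ev_ge v x; lra. Qed.

Lemma N_le x a : (forall v, ev v x <= a) -> N x <= a.
Proof. by move=> H; have [v <-] := ev_attain x. Qed.

Lemma N0 : N 0 = 0.
Proof. by have [v <-] := ev_attain 0; rewrite ev0. Qed.

Lemma N_opp x : N (- x) = N x.
Proof.
apply/eqP; rewrite eq_le; apply/andP; split; apply: N_le => v.
  by rewrite evN -ev_neg ev_le.
by rewrite -[ev v x]opprK -evN -ev_neg ev_le.
Qed.

Lemma N_sub x y : N (x - y) = N (y - x).
Proof. by rewrite -N_opp opprB. Qed.

Lemma N_triangle x y : N (x + y) <= N x + N y.
Proof. by apply: N_le => v; rewrite evD lerD ?ev_le. Qed.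

Lemma N_dist z x y : N (x - y) <= N (x - z) + N (z - y).
Proof. by apply: le_trans (N_triangle _ _); rewrite addrA subrK. Qed.

Lemma N_scale a x : 0 <= a -> N (a *: x) = a * N x.
Proof.
move=> a0; apply/eqP; rewrite eq_le; apply/andP; split.
  by apply: N_le => v; rewrite evZ ler_wpM2l ?ev_le.
by have [v <-] := ev_attain x; rewrite -evZ ev_le.
Qed.

Definition face d : {set V} := [set e | ev e d == N d].

Lemma faceP d e : reflect (ev e d = N d) (e \in face d).
Proof. by rewrite inE; apply: eqP. Qed.

Lemma face_opp d e : (neg e \in face (- d)) = (e \in face d).
Proof. by rewrite !inE ev_neg evN opprK N_opp. Qed.

Lemma face_lt d e : e \notin face d -> ev e d < N d.
Proof. by rewrite inE lt_neqAle ev_le andbT. Qed.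

(* [sand a A w]: the number [a] lies between the minimum and the maximum of
   [ev e w] over [e] in [A]. *)
Definition sand (a : R) A w :=
  (exists2 e, e \in A & a <= ev e w) /\ (exists2 e, e \in A & ev e w <= a).

Lemma sand_eq a A w s : sand a A w -> (forall e, e \in A -> ev e w = s) -> a = s.
Proof.
move=> [[e eA ae] [e' e'A ea]] H; apply/eqP; rewrite eq_le.
by rewrite -{1}(H e eA) -(H e' e'A) ae ea.
Qed.

Lemma sand_trans a A B w u :
  sand a A w -> (forall e, e \in A -> sand (ev e w) B u) -> sand a B u.
Proof.
move=> [[e eA ae] [e' e'A ea]] H; split.
  have [[c cB ec] _] := H e eA; exists c => //; exact: le_trans ec.
have [_ [c cB ec]] := H e' e'A; exists c => //; exact: le_trans ea.
Qed.

Lemma sand_sub a A B w : sand a A w -> A \subset B -> sand a B w.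
Proof.
by move=> [[e eA ae] [e' e'A ea]] /fintype.subsetP AB; split; [exists e|exists e'] => //; apply: AB.
Qed.

Lemma sand_closed a A w :
  (forall eps : R, 0 < eps -> exists2 b, `|a - b| <= eps & sand b A w) -> sand a A w.
Proof.
move=> H; split.
  apply: fin_closed => eps e0; have [b be [[v vA bv] _]] := H eps e0.
  by exists v => //; move: be; rewrite ler_norml; lra.
have [|v vA Hv] := @fin_closed R V A (fun v => - ev v w) (- a).
  move=> eps e0; have [b be [_ [v vA bv]]] := H eps e0.
  by exists v => //; move: be; rewrite ler_norml; lra.
by exists v => //; move: Hv; rewrite lerN2.
Qed.

(** The midpoint of [d1] and [d2] works: a common norming functional gives it norm 1, and the mean
    of two numbers at most 1 equals 1 only if both do. *)
Lemma expose_inter d1 d2 : N d1 = 1 -> N d2 = 1 -> (exists e, e \in face d1 :&: face d2) ->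
  exists d, N d = 1 /\ face d = face d1 :&: face d2.
Proof.
move=> n1 n2 [e]; rewrite !inE n1 n2 => /andP[/eqP e1 /eqP e2].
pose d := 2^-1 *: (d1 + d2).
have Nd : N d = 1.
  apply/eqP; rewrite eq_le; apply/andP; split.
    apply: N_le => v; rewrite !evE; have := ev_le v d1; have := ev_le v d2; lra.
  by have := ev_le e d; rewrite !evE e1 e2; lra.
exists d; split => //; apply/setP => v; rewrite !inE Nd n1 n2 !evE.
have := ev_le v d1; have := ev_le v d2; rewrite n1 n2 => a b.
by apply/eqP/andP => [h|[/eqP h /eqP h']]; [split; apply/eqP; lra|lra].
Qed.

Section Map.
Variable f : X -> X.
Hypothesis f0 : f 0 = 0.
Hypothesis fN : forall x y, N (f x - f y) <= N (x - y).
Hypothesis f_line : forall v y d (a b al be : R), a < b ->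
  (forall t, a <= t <= b -> ev v (f (y + t *: d)) = al + t * be) ->
  forall t, ev v (f (y + t *: d)) = al + t * be.

(** The increments of [ev v \o f] over the two parts of the segment are at most the lengths of these
    parts and add up to the whole length, so both bounds are equalities. [f_line] extends this from
    the segment to the line. *)
Lemma iso_line v x y : ev v (f x - f y) = N (x - y) ->
  forall t, ev v (f (y + t *: (x - y)) - f y) = t * N (x - y).
Proof.
move=> h t; rewrite evB (@f_line v y (x - y) 0 1 (ev v (f y)) (N (x - y))) //; first by lra.
move=> {}t /andP[t0 t1].
have h1 : ev v (f (y + t *: (x - y)) - f y) <= t * N (x - y).
  by apply: le_trans (ev_le _ _) _; apply: le_trans (fN _ _) _; rewrite addrC addKr N_scale.
have h2 : ev v (f x - f (y + t *: (x - y))) <= (1 - t) * N (x - y).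
  apply: le_trans (ev_le _ _) _; apply: le_trans (fN _ _) _.
  by rewrite opprD addrA -[X in X - t *: _]scale1r -scalerBl N_scale // subr_ge0.
move: h h1 h2; rewrite !evB; lra.
Qed.

(* [ev v \o f] is 1-Lipschitz and has slope 1 on the line [y + R d], so it lies
   between the Busemann functions of the two ends of that line. *)
Lemma horo_upper v y d w :
  (forall t, ev v (f (y + t *: d) - f y) = t * N d) ->
  exists2 e, e \in face d & ev v (f (y + w) - f y) <= ev e w.
Proof.
move=> H; apply/not_exists2P => nex.
set a := ev v (f (y + w) - f y) in nex.
(* Functionals outside the face fall behind linearly in [t], and those in the face are below [a] by
   assumption; one [t0] serves them all. *)
have [t0 [t00 Ht0]] : exists t0 : R, 0 <= t0 /\ forall t, t0 <= t -> forall e, ev e w + t * (ev e d - N d) < a.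
  apply: fin_eventually => e; have [eF|eF] := boolP (e \in face d).
    exists 0 => t _; move/faceP: (eF) => ->; rewrite subrr mulr0 addr0 ltNge; apply/negP => h.
    by case: (nex e).
  have := face_lt eF; rewrite -subr_gt0 => /(@affine_large R (ev e w - a + 1) 0) [t0 ht0].
  by exists t0 => t /ht0; lra.
have [e he] := ev_attain (w + t0 *: d).
have : ev v (f (y + w) - f (y - t0 *: d)) <= N (w + t0 *: d).
  apply: le_trans (ev_le _ _) _; apply: le_trans (fN _ _) _.
  by rewrite opprD opprK addrACA subrr add0r.
have := H (- t0); rewrite scaleNr !evB -he !evE.
by have := Ht0 t0 (lexx _) e; rewrite /a evB; lra.
Qed.

Lemma horo v y d w :
  (forall t, ev v (f (y + t *: d) - f y) = t * N d) ->
  sand (ev v (f (y + w) - f y)) (face d) w.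
Proof.
move=> H; split; first exact: horo_upper.
have [|e eF he] := @horo_upper (neg v) y (- d) w.
  by move=> t; rewrite scalerN -scaleNr ev_neg H N_opp mulNr opprK.
exists (neg e); first by rewrite -[d]opprK face_opp.
by rewrite ev_neg lerNl -ev_neg.
Qed.

Definition lin v d := N d = 1 /\ forall t, ev v (f (t *: d)) = t.

Lemma lin_sand v d w : lin v d -> sand (ev v (f w)) (face d) w.
Proof.
move=> [Nd H]; have := @horo v 0 d w; rewrite f0 subr0 add0r; apply => t.
by rewrite subr0 add0r Nd mulr1.
Qed.

(* If [ev e u = s] on the common face, then along [u + t (d1 - d2)] the lower
   bound of [d1] and the upper bound of [d2] both equal [s] for large [t], hence
   [ev v (f u) = s] by analyticity. Applied to [u = 0], [s = 0] and [s = 1] this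
   also shows that the two faces meet. *)
Lemma lin_inter v d1 d2 x : lin v d1 -> N d2 = 1 ->
  (forall w, sand (ev v (f (x + w) - f x)) (face d2) w) ->
  (forall e, e \in face d1 -> e \in face d2 -> ev e x = ev v (f x)) ->
  exists d, lin v d /\ face d = face d1 :&: face d2.
Proof.
move=> l1 n2 S2 compat; have [n1 _] := l1.
have key u s : (forall e, e \in face d1 -> e \in face d2 -> ev e u = s) -> ev v (f u) = s.
  move=> hu; pose z := d1 - d2.
  have [t0 [t00 Ht0]] : exists t0 : R, 0 <= t0 /\ forall t, t0 <= t -> forall e,
     (e \in face d1 -> s <= ev e (u + t *: z)) /\
     (e \in face d2 -> ev e (u + t *: z - x) + ev v (f x) <= s).
    apply: fin_eventually => e.
    have [e1|e1] := boolP (e \in face d1); have [e2|e2] := boolP (e \in face d2).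
    - exists 0 => t _; rewrite !evE (hu _ e1 e2) (compat _ e1 e2).
      move/faceP: e1 => ->; move/faceP: e2 => ->; rewrite n1 n2; split; lra.
    - have := face_lt e2; rewrite -subr_gt0 n2 => /(@affine_large R s (ev e u))[t0 ht0].
      exists t0 => t /ht0; rewrite !evE; move/faceP: e1 => ->; rewrite n1; split => //; lra.
    - have := face_lt e1; rewrite -subr_gt0 n1.
      move=> /(@affine_large R (ev v (f x) - ev e x - s + ev e u) 0)[t0 ht0].
      exists t0 => t /ht0; rewrite !evE; move/faceP: e2 => ->; rewrite n2; split => //; lra.
    - by exists 0.
  have -> : u = u + 0 *: z by rewrite scale0r addr0.
  rewrite (@f_line v u z t0 (t0 + 1) s 0) ?mul0r ?addr0 //; first by lra.
  move=> t /andP[tt0 _]; rewrite mulr0 addr0.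
  have [_ [e eF he]] := lin_sand (u + t *: z) l1.
  have [[e' e'F he'] _] := S2 (u + t *: z - x).
  have [h1 _] := Ht0 t tt0 e; have [_ h2] := Ht0 t tt0 e'.
  apply/eqP; rewrite eq_le (le_trans (h1 eF) he) andbT; apply: le_trans (h2 e'F).
  by move: he'; rewrite [x + _]addrC subrK evB; lra.
have [|d [nd Fd]] := expose_inter n1 n2.
  apply/not_existsP => nex; suff : (0 : R) = 1 by move/eqP; rewrite eq_sym oner_eq0.
  by rewrite -(key 0 0) ?(key 0 1) // => e e1 e2; case: (nex e); rewrite inE e1 e2.
exists d; split => //; split => // t; apply: key => e e1 e2; rewrite evZ.
have /faceP -> : e \in face d by rewrite Fd inE e1 e2.
by rewrite nd mulr1.
Qed.

(** * Recurrent points *)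

Hypothesis N_eq0 : forall x, N x = 0 -> x = 0.

Lemma iter_f_le k x y : N (iter k f x - iter k f y) <= N (x - y).
Proof. by elim: k => //= k IH; apply: le_trans IH. Qed.

Section Limits.
Variable U : set_system nat.
Hypothesis UF : ProperFilter U.
Hypothesis U_infty : forall k, U [set j | (k <= j)%N].
Hypothesis U_limit : forall S : nat -> X, (exists C, forall j, N (S j) <= C) ->
  exists l, forall eps : R, 0 < eps -> U [set j | N (S j - l) < eps].

(* [limit_at m a x] : [x] is the [U]-limit of [f^(j! - m) a] as [j] grows; since
   every integer eventually divides [j!], such limits with [m = 0] are limits
   along multiples of any prescribed period. *)
Definition limit_at m a x :=
  forall eps : R, 0 < eps -> U [set j | N (iter (j`! - m) f a - x) < eps].

Lemma U_ex3 (A B C : set nat) : U A -> U B -> U C -> exists j, [/\ A j, B j & C j].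
Proof.
move=> UA UB UC; have UAB : U (A `&` B) by apply: filterI.
have : U ((A `&` B) `&` C) by apply: filterI.
by move=> /filter_ex[j [[]]]; exists j.
Qed.

Lemma limit_exists m a : exists x, limit_at m a x.
Proof.
apply: U_limit; exists (N a) => j.
have := iter_f_le (j`! - m) a 0.
by have -> : iter (j`! - m) f 0 = 0; [elim: (j`! - m)%N => //= k ->|rewrite !subr0].
Qed.

Lemma fact_infty k : U [set j | (k <= j`!)%N].
Proof. by apply: filterS (U_infty k) => j /= kj; apply: leq_trans kj (fact_geq j). Qed.

Lemma limit_shift m c a x : limit_at m a x -> limit_at (m + c) (iter c f a) x.
Proof.
move=> H eps e0; apply: filterS2 (fact_infty (m + c)) (H eps e0) => j /= jm h.
by rewrite -iterD; have -> : (j`! - (m + c) + c = j`! - m)%N by lia.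
Qed.

(** Both points are limits with the common offset [M]. At a late time [k] the orbits are again near
    [x] and [y], while their distance is at most the one just after time [j], which is nearly
    [N (f x - f y)]. Hence [f] does not shrink [N (x - y)]. *)
Lemma limit_iso m l a b x y : limit_at m a x -> limit_at l b y ->
  N (f x - f y) = N (x - y).
Proof.
move=> /(limit_shift l)ax /(limit_shift m); rewrite [(l + m)%N]addnC => bY.
set M := (m + l)%N in ax bY; move: (iter l f a) (iter m f b) ax bY => a' b' ax bY.
apply/eqP; rewrite eq_le fN /=; apply/ler_addgt0Pr => eps e0.
have e40 : 0 < eps / 4 by lra.
have [j [/= jx jy _]] := U_ex3 (ax _ e40) (bY _ e40) (bY _ e40).
have [k [/= kx ky jk]] := U_ex3 (ax _ e40) (bY _ e40) (fact_infty (M + (j`! - M).+1)).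
have h1 : N (x - y) <= eps / 2 + N (iter (k`! - M) f a' - iter (k`! - M) f b').
  have := N_dist (iter (k`! - M) f a') x y; rewrite (N_sub x (iter _ _ _)).
  have := N_dist (iter (k`! - M) f b') (iter (k`! - M) f a') y; lra.
have h2 : N (iter (k`! - M) f a' - iter (k`! - M) f b') <=
    N (f (iter (j`! - M) f a') - f (iter (j`! - M) f b')).
  have -> : (k`! - M = (k`! - M - (j`! - M).+1) + (j`! - M).+1)%N by lia.
  by rewrite !iterD; apply: iter_f_le.
have h3 : N (f (iter (j`! - M) f a') - f (iter (j`! - M) f b')) <= eps / 2 + N (f x - f y).
  have := N_dist (f x) (f (iter (j`! - M) f a')) (f (iter (j`! - M) f b')).
  have := N_dist (f y) (f x) (f (iter (j`! - M) f b')).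
  have := fN (iter (j`! - M) f a') x; have := fN y (iter (j`! - M) f b').
  rewrite (N_sub y); lra.
lra.
Qed.

Lemma limit_f m a x : limit_at m a x -> limit_at m (f a) (f x).
Proof.
move=> H eps e0; apply: filterS (H eps e0) => j /=; rewrite -iterSr /=.
exact/le_lt_trans/fN.
Qed.

Lemma limit_surj m a x : limit_at m a x -> exists2 y, limit_at m.+1 a y & f y = x.
Proof.
move=> H; have [y Hy] := limit_exists m.+1 a; exists y => //.
apply/eqP; rewrite -subr_eq0; apply/eqP/N_eq0/le_anti; rewrite N_ge0 andbT.
apply/ler_addgt0Pr => eps e0; rewrite add0r; have e20 : 0 < eps / 2 by lra.
have [j [/= jx jy jm]] := U_ex3 (H _ e20) (Hy _ e20) (fact_infty m.+1).
move: jx; have -> : (j`! - m = (j`! - m.+1).+1)%N by lia.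
move=> /= jx; apply: le_trans (N_dist (f (iter (j`! - m.+1) f a)) _ _) _.
have := fN y (iter (j`! - m.+1) f a); rewrite (N_sub y); lra.
Qed.

(** [Om] consists of the limits for all offsets, which makes [f] onto on it; [P] uses offset 0. A
    single ultrafilter governs all limits, so two points are approximated at the same time [k]. *)
Lemma limit_set : exists (Om : X -> Prop) (P : X -> X),
  [/\ Om 0, forall x, Om x -> Om (f x),
      forall x, Om x -> exists2 y, Om y & f y = x,
      forall x y, Om x -> Om y -> N (f x - f y) = N (x - y) &
      forall x, Om (P x)] /\
  forall x y (eps : R) m, 0 < eps -> (0 < m)%N ->
    exists k, [/\ (0 < k)%N, (m %| k)%N, N (P x - iter k f x) < eps
                & N (P y - iter k f y) < eps].
Proof.
have /choice[P HP] := limit_exists 0.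
exists (fun x => exists m a, limit_at m a x), P; split; first split.
- exists 0%N, 0 => eps e0; apply: filterS filterT => j _ /=.
  have -> : iter (j`! - 0) f 0 = 0 by elim: (j`! - 0)%N => //= k ->.
  by rewrite subr0 N0.
- by move=> x [m [a H]]; exists m, (f a); apply: limit_f.
- by move=> x [m [a /limit_surj[y Hy <-]]]; exists y => //; exists m.+1, a.
- by move=> x y [m [a Hx]] [l [b Hy]]; apply: limit_iso Hx Hy.
- by move=> x; exists 0%N, x; apply: HP.
move=> x y eps m e0 m0.
have [j [/= jx jy mj]] := U_ex3 (HP x _ e0) (HP y _ e0) (U_infty m).
rewrite subn0 in jx jy; exists j`!; split; rewrite ?fact_gt0 // 1?N_sub //.
by rewrite dvdn_fact // m0.
Qed.
End Limits.

Section Recurrent.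
Variables (Om : X -> Prop) (P : X -> X).
Hypothesis Om0 : Om 0.
Hypothesis Omf : forall x, Om x -> Om (f x).
Hypothesis Om_surj : forall x, Om x -> exists2 y, Om y & f y = x.
Hypothesis Om_iso : forall x y, Om x -> Om y -> N (f x - f y) = N (x - y).
Hypothesis OmP : forall x, Om (P x).
Hypothesis P_approx : forall x y (eps : R) m, 0 < eps -> (0 < m)%N ->
  exists k, [/\ (0 < k)%N, (m %| k)%N, N (P x - iter k f x) < eps
              & N (P y - iter k f y) < eps].

Lemma Om_iter k x : Om x -> Om (iter k f x).
Proof. by move=> Ox; elim: k => //= k; apply: Omf. Qed.

Lemma Om_iter_surj k x : Om x -> exists2 y, Om y & iter k f y = x.
Proof.
elim: k x => [|k IH] x Ox; first by exists x.
have [y Oy <-] := Om_surj Ox; have [z Oz <-] := IH y Oy.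
by exists z.
Qed.

Lemma Om_iter_iso k x y : Om x -> Om y -> N (iter k f x - iter k f y) = N (x - y).
Proof. by move=> Ox Oy; elim: k => //= k IH; rewrite Om_iso ?IH //; apply: Om_iter. Qed.

Lemma iter_f0 k : iter k f 0 = 0. Proof. by elim: k => //= k ->. Qed.

Lemma Om_iterN k x : Om x -> N (iter k f x) = N x.
Proof. by move=> Ox; have := Om_iter_iso k Ox Om0; rewrite iter_f0 !subr0. Qed.

Lemma OmN x : Om x -> N (f x) = N x.
Proof. exact: (@Om_iterN 1). Qed.

Lemma P_N x : N (P x) <= N x.
Proof.
apply/ler_addgt0Pr => eps e0; have [k [_ _ h _]] := P_approx x x e0 (ltn0Sn 0).
have := iter_f_le k x 0; rewrite iter_f0 !subr0 => h2.
have := N_triangle (P x - iter k f x) (iter k f x); rewrite subrK; lra.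
Qed.

Lemma Om_recurrent p x (eps : R) : Om x -> 0 < eps -> (0 < p)%N ->
  exists l y, [/\ Om y, iter (p * l.+1) f y = x & N (y - x) < eps].
Proof.
move=> Ox e0 p0; have e20 : 0 < eps / 2 by lra.
have [k1 [k10 /dvdnP[c1 ck1] h1 _]] := P_approx x x e20 p0.
(* The second time is a multiple of twice the first, hence strictly later. Both iterates of [x] are
   near [P x], so the difference of the two times almost returns [x] to itself. *)
have [|k2 [k20 /dvdnP[c2 ck2] h2 _]] := P_approx x x e20 (_ : 0 < p * c1.*2)%N.
  by move: k10; rewrite ck1 !muln_gt0 double_gt0 p0 => /andP[->].
have c10 : (0 < c1)%N by move: k10; rewrite ck1 muln_gt0 => /andP[].
have c20 : (0 < c2)%N by move: k20; rewrite ck2 muln_gt0 => /andP[].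
have lt : (c1 < c2 * c1.*2)%N.
  by apply: leq_trans (leq_pmull _ c20); rewrite -addnn -[X in (X < _)%N]addn0 ltn_add2l.
have kk : (k2 = k1 + p * ((c2 * c1.*2 - c1).-1).+1)%N.
  rewrite prednK ?subn_gt0 // mulnBr ck1 [(c1 * p)%N]mulnC subnKC.
    by rewrite ck2 mulnCA.
  by rewrite leq_mul2l ltnW ?orbT.
exists (c2 * c1.*2 - c1).-1; set l := _.-1 in kk *.
have [y Oy yx] := Om_iter_surj (p * l.+1) Ox; exists y; split => //.
rewrite -(Om_iter_iso (p * l.+1) Oy Ox) yx -(Om_iter_iso k1) //; last exact: Om_iter.
rewrite -iterD -kk; apply: le_lt_trans (N_dist (P x) _ _) _.
rewrite N_sub; lra.
Qed.

(* With the cone [C v = {x | ev v x = N x}] of [Om], [below v k e] says that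
   [f^-k (C v)] lies in [C e], and [f^-k (C (neg v))] in [C (neg e)];
   [above v k e] states the reverse inclusions. *)
Definition below v k e :=
  forall x, Om x -> `|ev v (iter k f x)| = N x -> ev e x = ev v (iter k f x).
Definition above v k e :=
  forall x, Om x -> `|ev e x| = N x -> ev v (iter k f x) = ev e x.

Lemma below_refl v : below v 0 v. Proof. by []. Qed.

Lemma below_trans v k e l c : below v k e -> below e l c -> below v (k + l) c.
Proof.
move=> ve ed x Ox; rewrite iterD => h; have Ol := Om_iter l Ox.
have ve' := ve _ Ol; rewrite Om_iterN // in ve'.
by rewrite -ve' //; apply: ed => //; rewrite ve'.
Qed.

Lemma above_trans v k e l c : above v k e -> above e l c -> above v (k + l) c.
Proof.
move=> ve ed x Ox h; have Ol := Om_iter l Ox; have ed' := ed x Ox h.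
by rewrite iterD ve // ed' // Om_iterN.
Qed.

Lemma below_of_ab v k c e : above v k c -> below v k e -> below c 0 e.
Proof. by move=> vd ve x Ox /= h; rewrite -(vd x Ox h); apply: ve => //; rewrite vd. Qed.

Lemma below_of_ba v k c e : below v k c -> above e k c -> below v 0 e.
Proof.
move=> vd ed x Ox /= h; have [y Oy yx] := Om_iter_surj k Ox.
have Ny : N y = N x by rewrite -yx Om_iterN.
have vc : ev c y = ev v x by rewrite -yx; apply: vd => //; rewrite yx h.
by rewrite -{1}yx ed // vc // h.
Qed.

Lemma below_muln v p k : below v p v -> below v (p * k) v.
Proof.
move=> h; elim: k => [|k IH]; first by rewrite muln0; apply: below_refl.
by rewrite mulnS; apply: below_trans h IH.
Qed.

Lemma above_muln v p k : above v p v -> above v (p * k) v.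
Proof.
move=> h; elim: k => [|k IH]; first by rewrite muln0; apply: below_refl.
by rewrite mulnS; apply: above_trans h IH.
Qed.

Lemma below_neg v e : below v 0 e -> below (neg v) 0 (neg e).
Proof. by move=> ve x Ox /=; rewrite !ev_neg normrN => h; rewrite ve. Qed.

(** By recurrence some [y] near [x] is mapped onto [x] by a positive number of blocks of [p] steps.
    Undoing all blocks but the first, the hypothesis gives [ev v] the value [ev v x] at the [p]-th
    iterate of [y], which is as close to that of [x] as [y] is to [x]. *)
Lemma below_recurrent v p : (0 < p)%N -> below v p v -> above v p v.
Proof.
move=> p0 vv x Ox h; apply/eqP; rewrite -subr_eq0 -normr_eq0.
apply/eqP/le_anti; rewrite normr_ge0 andbT.
apply/ler_addgt0Pr => eps e0; rewrite add0r.
have [l [y [Oy yx yxe]]] := Om_recurrent Ox e0 p0.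
have Op := Om_iter p Oy.
have h1 : ev v (iter p f y) = ev v x.
  have := below_muln (k := l) vv Op; rewrite -iterD addnC -mulnS yx; apply.
  by rewrite h -yx Om_iterN // Om_iterN.
rewrite -h1 -evB; apply: le_trans (ev_abs _ _) _; rewrite Om_iter_iso // N_sub.
exact: ltW.
Qed.

(** * Active functionals, maximal cones and their cycles *)

Definition active v := exists2 x, Om x & N x != 0 /\ `|ev v x| = N x.

Lemma active_below v k e : active v -> below v k e -> active e.
Proof.
move=> [x Ox [Nx vx]] ve; have [y Oy yx] := Om_iter_surj k Ox.
have Ny : N y = N x by rewrite -yx Om_iterN.
exists y => //; rewrite Ny; split => //.
by rewrite ve // yx // Ny.
Qed.

(** Along [t *: y] the slope of [ev v \o f] is [ev v (f y)], of modulus [N y]; the scalar, possibly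
    negative, normalizes it to 1. *)
Lemma lin_of v y : Om y -> N y != 0 -> `|ev v (f y)| = N y ->
  lin v ((ev v (f y))^-1 *: y).
Proof.
move=> Oy Ny vy; set c := ev v (f y) in vy *.
have c0 : c != 0 by rewrite -normr_eq0 vy.
have line t : ev v (f (t *: y)) = t * c.
  have [c1|c1] := leP 0 c.
    have := @iso_line v y 0; rewrite f0 !subr0 -/c => /(_ _ t).
    by rewrite add0r -vy ger0_norm // subr0; apply.
  have := @iso_line (neg v) y 0; rewrite f0 !subr0 ev_neg -/c => /(_ _ t).
  rewrite add0r -vy ltr0_norm // subr0 ev_neg mulrN => /(_ erefl).
  by move/oppr_inj.
split.
  have [c1|c1] := leP 0 c; first by rewrite N_scale ?invr_ge0 // -vy ger0_norm // mulVf.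
  rewrite -N_opp -scaleNr N_scale ?oppr_ge0 ?invr_le0 ?ltW //.
  by rewrite -vy ltr0_norm // mulrNN mulVf.
by move=> t; rewrite scalerA line -mulrA mulVf ?mulr1.
Qed.

Lemma minimal_face (Q : X -> Prop) : (exists d, Q d) ->
  exists2 d, Q d & forall d', Q d' -> face d' \subset face d -> face d' = face d.
Proof.
move=> [d0 Qd0]; pose T n := `[< exists2 d, Q d & #|face d| = n >].
have exT : exists n, T n by exists #|face d0|; apply/asboolP; exists d0.
case: (ex_minnP exT) => n /asboolP[d Qd <-] mind; exists d => // d' Qd' sub.
apply/eqP; rewrite eqEcard sub; apply: mind; apply/asboolP; by exists d'.
Qed.

Definition good v d := lin v d /\ forall e, e \in face d -> below v 1 e.

(** Among the [d] with [lin v d] take one with the smallest face. A nonzero recurrent [x] such that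
    [v] norms [f x] up to sign yields a second such direction by [lin_of]. By [lin_inter] the two
    faces intersect in a face of the same kind, so by minimality the smallest face lies in the
    second one. *)
Lemma good_exists v : active v -> exists d, good v d.
Proof.
move=> [x0 Ox0 [Nx0 vx0]]; have [y0 Oy0 yx0] := Om_surj Ox0.
have [|d lind mind] := @minimal_face (lin v).
  by exists ((ev v (f y0))^-1 *: y0); apply: lin_of => //; rewrite -OmN ?yx0.
exists d; split => // e ed x Ox /= vx.
have [Nx|Nx] := eqVneq (N x) 0.
  have /eqP := vx; rewrite Nx normr_eq0 => /eqP ->; apply/eqP.
  by rewrite -normr_le0 -Nx ev_abs.
have lin2 := lin_of Ox Nx vx; have [n2 _] := lin2.
have [|e' _ _|d' [lind' Fd']] := @lin_inter v d _ 0 lind n2.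
- by move=> w; rewrite f0 subr0 add0r; apply: lin_sand.
- by rewrite f0 !ev0.
have := mind d' lind'; rewrite Fd' subsetIl => /(_ isT) /finset.setP h0; have := h0 e.
rewrite inE ed /= => /faceP; rewrite n2 evZ => h.
have c0 : ev v (f x) != 0 by rewrite -normr_eq0 vx.
by apply: (mulfI (invr_neq0 c0)); rewrite h mulVf.
Qed.

Lemma face_neq0 d : exists e, e \in face d.
Proof. by have [e he] := ev_attain d; exists e; apply/faceP. Qed.

Definition maxi v := active v /\ forall e, below v 0 e -> below e 0 v.

(** For maximal [v] these are the functionals defining the same cone as [v]; such classes are equal
    or disjoint. *)
Definition cls v : {set V} := [set e | `[< below v 0 e >]]%SET.

Lemma clsP v e : reflect (below v 0 e) (e \in cls v).
Proof. by rewrite inE; apply: asboolP. Qed.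

Lemma cls_refl v : v \in cls v. Proof. exact/clsP/below_refl. Qed.

Lemma maxi_exists v : active v -> exists2 e, maxi e & below v 0 e.
Proof.
move=> av; case: (arg_minnP (fun e => #|cls e|) (cls_refl v)) => e /clsP ve mine.
exists e => //; split; first exact: active_below av ve.
move=> c ec; have sub : cls c \subset cls e.
  by apply/fintype.subsetP => b /clsP cb; apply/clsP; apply: below_trans ec cb.
apply/clsP; have -> : cls c = cls e; last exact: cls_refl.
apply/eqP; rewrite eqEcard sub; apply/mine/clsP; exact: below_trans ve ec.
Qed.

Lemma maxi_below v e : maxi v -> below v 0 e -> maxi e.
Proof.
move=> [av mv] ve; split; first exact: active_below av ve.
move=> c ec; apply: (@below_trans c 0 v 0 e _ ve).
by apply: mv; apply: (below_trans ve ec).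
Qed.

Lemma maxi_neg v : maxi v -> maxi (neg v).
Proof.
move=> [[x Ox [Nx vx]] mv]; split.
  by exists x => //; split => //; rewrite ev_neg normrN.
move=> e ve y Oy /= h.
have /mv nev : below v 0 (neg e).
  move=> z Oz /= hz; rewrite ev_neg ve //= ev_neg ?opprK //; by rewrite normrN.
by rewrite ev_neg (nev y Oy) /= ev_neg ?opprK // normrN.
Qed.

(** Following successors from [v] leads into a cycle. Recurrence along the cycle and maximality of
    [v] bring the chain back to the cone of [v], and going once around reverses the inclusion
    between [v] and [e]. *)
Lemma maxi_cycle v e : maxi v -> below v 1 e ->
  [/\ exists2 p, (0 < p)%N & below v p v /\ above v p v, above v 1 e & maxi e].
Proof.
move=> mv ve; have [av _] := mv.
have /choice[nx0 nx0P] : forall b, exists c, active b -> below b 1 c.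
  move=> b.
  have [aw|naw] := pselect (active b); last by exists b.
  have [d [_ gd]] := good_exists aw; have [c cd] := face_neq0 d.
  by exists c => _; apply: gd.
pose nx b := if b == v then e else nx0 b.
have nxP b : active b -> below b 1 (nx b).
  by rewrite /nx; case: eqP => [->|_] // /nx0P.
have chain k b : active b -> below b k (iter k nx b).
  move=> aw; elim: k => [|k IH] /=; first exact: below_refl.
  rewrite -addn1; apply: (below_trans IH); apply: nxP.
  exact: active_below aw IH.
have [p [p0 pD]] := iter_idem nx v; set D := iter p nx v in pD.
have vD : below v p D by apply: chain.
have aD := active_below av vD.
have DD : below D p D by rewrite -{2}pD; apply: chain.
have DDa := below_recurrent p0 DD.
have vD0 := below_of_ba vD DDa; have Dv0 := mv.2 _ vD0.
have vv : below v p v by rewrite -[p]addn0; apply: below_trans vD Dv0.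
have vva := below_recurrent p0 vv.
have p1 : p = (p.-1 + 1)%N by rewrite addn1 prednK.
have eD : below e p.-1 v.
  rewrite -[p.-1]addn0; apply: below_trans Dv0.
  have -> : D = iter p.-1 nx e by rewrite /D p1 addn1 iterSr /nx eqxx.
  by apply: chain; apply: active_below av ve.
(* The point [y] lying [p.-1] steps before [x] is in the cone of [v] or of [neg v], hence so is its
   [p]-th iterate [f x]. *)
have pull c : below c p.-1 v -> forall x, Om x -> `|ev c x| = N x -> ev v (f x) = ev c x.
  move=> cv x Ox h; have [y Oy yx] := Om_iter_surj p.-1 Ox.
  have vy : ev v y = ev c x by rewrite -yx; apply: cv => //; rewrite yx h -yx Om_iterN.
  have := vva y Oy; rewrite vy p1 addn1 /= yx; apply.
  by rewrite h -yx Om_iterN.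
split; [by exists p | by move=> x Ox /=; apply: pull|split; first exact: active_below av ve].
move=> c ec x Ox /= h.
have ac : active c by apply: active_below av (below_trans ve ec).
have cv : below c p.-1 v.
  rewrite -[p.-1]addn0; apply: below_trans (chain p.-1 c ac) _; apply: mv.2.
  apply: below_of_ab vva _; rewrite p1 addnC -[1%N]addn0.
  by apply: below_trans (below_trans ve ec) (chain _ _ ac).
by rewrite -(pull c cv x Ox h); apply: ve => //=; rewrite (pull c).
Qed.

Lemma maxi_good v : maxi v -> exists d, lin v d /\
  forall e, e \in face d -> [/\ maxi e, below v 1 e & above v 1 e].
Proof.
move=> mv; have [d [ld gd]] := good_exists mv.1; exists d; split => // e /gd ve.
by have [] := maxi_cycle mv ve.
Qed.

Lemma maxi_period : exists2 o, (0 < o)%N &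
  forall k v, (o %| k)%N -> maxi v -> below v k v /\ above v k v.
Proof.
have /choice[p pP] : forall v, exists q, (0 < q)%N /\
    (maxi v -> below v q v /\ above v q v).
  move=> v.
  have [mv|nmv] := pselect (maxi v); last by exists 1%N.
  have [d [_ gd]] := good_exists mv.1; have [e ed] := face_neq0 d.
  have [[q q0 h] _ _] := maxi_cycle mv (gd e ed); by exists q.
exists (\prod_v p v)%N; first by apply: prodn_cond_gt0 => v _; have [] := pP v.
move=> k v dv mv; have [_ /(_ mv)[b a]] := pP v.
have /dvdnP[c ->] : (p v %| k)%N by apply: dvdn_trans dv; rewrite (bigD1 v) //= dvdn_mulr.
by rewrite mulnC; split; [apply: below_muln|apply: above_muln].
Qed.

Lemma maxi_cls v e : maxi v -> e \in cls v -> maxi e.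
Proof. by move=> mv /clsP; apply: maxi_below. Qed.

Lemma cls_sub v e : below v 0 e -> cls e \subset cls v.
Proof.
move=> ve; apply/fintype.subsetP => c /clsP ec; apply/clsP.
exact: below_trans ve ec.
Qed.

Lemma cls_eq v e : maxi v -> below v 0 e -> cls e = cls v.
Proof.
by move=> mv ve; apply/eqP; rewrite finset.eqEsubset !cls_sub //; apply: mv.2.
Qed.

Lemma cls_disjoint v e c : maxi e -> c \in cls v -> c \in cls e -> e \in cls v.
Proof.
by move=> me /clsP vc /clsP /me.2 ce; apply/clsP; apply: below_trans vc ce.
Qed.

(** * The limit map [P] and the maximal functionals *)

Lemma iter_sand v k u : maxi v -> exists2 A : {set V},
  (forall e, e \in A -> below v k e) & sand (ev v (iter k f u)) A u.
Proof.
elim: k v => [|k IH] v mv.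
  exists (cls v); first by move=> e /clsP.
  by split; exists v; rewrite ?cls_refl.
exists [set e | `[< below v k.+1 e >]]%SET; first by move=> e; rewrite inE => /asboolP.
have [d [ld gd]] := maxi_good mv.
apply: sand_trans (lin_sand (iter k f u) ld) _ => e /gd[me ve _].
have [A AP sA] := IH e me; apply: sand_sub sA _.
apply/fintype.subsetP => c /AP ec; rewrite inE; apply/asboolP.
rewrite -addn1 addnC; exact: below_trans ve ec.
Qed.

(** At times divisible by the common period of the maximal cones, the functionals bounding [ev v] of
    the iterate belong to the class of [v]; the bounds pass to the limit because a class is
    finite. *)
Lemma P_sand v u : maxi v -> sand (ev v (P u)) (cls v) u.
Proof.
move=> mv; apply: sand_closed => eps e0.
have [per per0 perP] := maxi_period.
have [k [_ ok h _]] := P_approx u u e0 per0; have [_ vk] := perP k v ok mv.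
exists (ev v (iter k f u)); first by rewrite -evB (le_trans (ev_abs _ _)) // ltW.
have [A AP sA] := iter_sand k u mv; apply: sand_sub sA _.
apply/fintype.subsetP => e /AP ve; apply/clsP; exact: below_of_ab vk ve.
Qed.

Lemma iter_line k x y e w : Om x -> Om y ->
  ev e (iter k f x - iter k f y) = N (x - y) ->
  sand (ev e (iter k f w - iter k f y)) (face (x - y)) (w - y).
Proof.
move=> Ox Oy; elim: k e => [|k IH] e /= he.
  by split; exists e => //; apply/faceP.
have Ni := Om_iter_iso k Ox Oy.
have line := @iso_line e (iter k f x) (iter k f y).
rewrite he Ni in line; have {}line := line erefl; rewrite -Ni in line.
have := horo (iter k f w - iter k f y) line.
rewrite [iter k f y + _]addrC subrK => /sand_trans; apply.
by move=> c /faceP; rewrite Ni; apply: IH.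
Qed.

(** At each time [k], a functional norming the difference of the iterates of [x] and [y] has slope
    [N (x - y)] in [t] along the whole line by [iter_line]; the iterates then tend to [P]. *)
Lemma P_line x y t : Om x -> Om y -> 0 <= t ->
  t * N (x - y) <= N (P (y + t *: (x - y)) - P y).
Proof.
move=> Ox Oy t0; set w := y + _.
apply/ler_addgt0Pr => eps e0; have e20 : 0 < eps / 2 by lra.
have [k [_ _ hw hy]] := P_approx w y e20 (ltn0Sn 0).
have [e he] := ev_attain (iter k f x - iter k f y).
rewrite (Om_iter_iso k Ox Oy) in he.
have h : t * N (x - y) <= N (iter k f w - iter k f y).
  rewrite -(sand_eq (iter_line w Ox Oy he) (s := t * N (x - y))); first exact: ev_le.
  by move=> c /faceP hc; rewrite /w addrAC subrr add0r evZ hc.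
apply: le_trans h _; apply: le_trans (N_dist (P w) _ _) _.
have := N_dist (P y) (P w) (iter k f y).
rewrite [N (iter k f w - _)]N_sub; lra.
Qed.

(* [P] is isometric on the line through [x] and [y], and at a point [w] far away
   on this line [N (P w)] is bounded by the maximal functionals at [w]. *)
Lemma norming x y : Om x -> Om y -> N (x - y) != 0 ->
  exists2 v, maxi v & ev v (x - y) = N (x - y).
Proof.
move=> Ox Oy nz; have n0 : 0 < N (x - y) by rewrite lt_def nz N_ge0.
have [|v] := @fin_closed R V [set v | `[< maxi v >]]%SET (fun v => ev v (x - y)) (N (x - y)); last first.
  rewrite inE => /asboolP mv h; exists v => //; apply/eqP.
  by rewrite eq_le h ev_le.
move=> eps e0; have Ny := N_ge0 y; pose C := 2 * N y + 1.
(* The first summand makes the error [2 * N y] at most [t * eps], the second keeps [P w] away from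
   0. *)
pose t := C / eps + C / N (x - y).
have C0 : 0 < C by rewrite /C; lra.
have te : C <= t * eps.
  by rewrite /t mulrDl divfK ?gt_eqF // lerDl; apply: mulr_ge0; [apply: divr_ge0|]; exact: ltW.
have tn : C <= t * N (x - y).
  by rewrite /t mulrDl divfK // lerDr; apply: mulr_ge0; [apply: divr_ge0|]; exact: ltW.
have t0 : 0 < t by rewrite /t addr_gt0 // divr_gt0.
set w := y + t *: (x - y).
have h1 := P_line Ox Oy (ltW t0); have h2 := N_triangle (P w) (- P y).
rewrite N_opp in h2; have h3 := P_N y.
have Pw0 : 0 < N (P w) by move: te tn h1 h2; rewrite /C -/w; lra.
have [v hv] := ev_attain (P w).
have [|e me ve] := @maxi_exists v.
  by exists (P w) => //; split; [rewrite gt_eqF|rewrite hv ger0_norm // ltW].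
have he : ev e (P w) = N (P w).
  by rewrite -hv; apply: ve => //=; rewrite hv ger0_norm // ltW.
have [[c cA hc] _] := P_sand w me.
exists c; first by rewrite inE; apply/asboolP; apply: maxi_cls cA.
rewrite -(ler_pM2l t0).
move: hc h1 h2 te tn; rewrite he /w !evE -!/w /C -evB; have := ev_le c y; lra.
Qed.

(** Take a smallest face containing the class. Each nonzero point of the cone exposes, after
    scaling, a face that contains the class; by [expose_inter] and minimality the smallest face lies
    inside it, so its members norm the whole cone. *)
Lemma maxi_expose v : maxi v -> exists d, N d = 1 /\ face d = cls v.
Proof.
move=> mv; have [[x0 Ox0 [Nx0 vx0]] _] := mv.
have unit x : N x != 0 -> `|ev v x| = N x ->
    N ((ev v x)^-1 *: x) = 1 /\ forall e, ev e x = ev v x <-> e \in face ((ev v x)^-1 *: x).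
  move=> Nx vx; have c0 : ev v x != 0 by rewrite -normr_eq0 vx.
  have n1 : N ((ev v x)^-1 *: x) = 1.
    have [c1|c1] := leP 0 (ev v x).
      by rewrite N_scale ?invr_ge0 // -vx ger0_norm // mulVf.
    rewrite -N_opp -scaleNr N_scale ?oppr_ge0 ?invr_le0 ?ltW //.
    by rewrite -vx ltr0_norm // mulrNN mulVf.
  split => // e; split => [h|/faceP].
    by apply/faceP; rewrite n1 evZ h mulVf.
  by rewrite n1 evZ => h; apply: (mulfI (invr_neq0 c0)); rewrite h mulVf.
have [n0 F0] := unit _ Nx0 vx0.
have [|d [nd sd] mind] := @minimal_face (fun d => N d = 1 /\ cls v \subset face d).
  eexists; split; first exact: n0.
  by apply/fintype.subsetP => e /clsP ve; apply/F0; apply: ve.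
exists d; split => //; apply/eqP; rewrite finset.eqEsubset sd andbT.
apply/fintype.subsetP => e ed; apply/clsP => x Ox /= vx.
have [Nx|Nx] := eqVneq (N x) 0.
  have /eqP := vx; rewrite Nx normr_eq0 => /eqP ->; apply/eqP.
  by rewrite -normr_le0 -Nx ev_abs.
have [nx Fx] := unit _ Nx vx; apply/Fx.
have sx : cls v \subset face ((ev v x)^-1 *: x).
  by apply/fintype.subsetP => c /clsP vc; apply/Fx; apply: vc.
have [|d' [nd' Fd']] := expose_inter nd nx.
  by exists v; rewrite inE (fintype.subsetP sd) ?(fintype.subsetP sx) ?cls_refl.
have := mind d'; rewrite Fd' subsetIl finset.subsetI sd sx => /(_ (conj nd' isT) isT) h.
by move: ed; rewrite -h inE => /andP[].
Qed.

(** * Agreement of the functionals of one class on [Om] *)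

Definition kmin v x := [set e in cls v | [forall c in cls v, ev e x <= ev c x]]%SET.

Lemma kminP v x e : reflect (e \in cls v /\ forall c, c \in cls v -> ev e x <= ev c x)
  (e \in kmin v x).
Proof.
rewrite [e \in kmin _ _]finset.in_set; apply: (iffP andP) => -[ec H]; split => //.
  by move=> c cv; move/forallP/(_ c)/implyP: H; apply.
by apply/forallP => c; apply/implyP; apply: H.
Qed.

Lemma kmin_exists v x : exists e, e \in kmin v x.
Proof.
case: (arg_minP (fun e => ev e x) (cls_refl v)) => e ev_ H.
by exists e; apply/kminP.
Qed.

Lemma kmin_cls v e x : maxi v -> below v 0 e -> kmin e x = kmin v x.
Proof. by move=> mv ve; rewrite /kmin (cls_eq mv ve). Qed.

(* A point of [Om] deep inside the cone of [v]: all other maximal functionals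
   are smaller there by an arbitrary margin. *)
Lemma deep_point v C : maxi v -> exists p t, [/\ Om p, N p = t, C <= t,
  forall e, e \in cls v -> ev e p = t &
  forall e, maxi e -> e \notin cls v -> ev e p + C <= t].
Proof.
move=> mv; have [d [nd Fd]] := maxi_expose mv.
have [t0 [t00 Ht0]] : exists t0 : R, 0 <= t0 /\ forall t, t0 <= t -> forall e,
    e \notin cls v -> t * ev e d + C <= t.
  apply: fin_eventually => e; have [ec|ec] := boolP (e \in cls v); first by exists 0.
  have : ev e d < 1 by rewrite -nd; apply: face_lt; rewrite Fd.
  rewrite -subr_gt0 => /(@affine_large R C 0)[t0 h]; exists t0 => t /h; lra.
pose t := Num.max t0 C; have tt0 : t0 <= t by rewrite le_max lexx.
have t_ge0 : 0 <= t by apply: le_trans tt0.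
have on e : e \in cls v -> ev e (P (t *: d)) = t.
  move=> ec; apply: sand_eq (P_sand _ (maxi_cls mv ec)) _ => c.
  move/clsP in ec; rewrite (cls_eq mv ec) -Fd => /faceP hc.
  by rewrite evZ hc nd mulr1.
exists (P (t *: d)), t; split => //.
- apply/eqP; rewrite eq_le; apply/andP; split; last first.
    by have := ev_le v (P (t *: d)); rewrite on ?cls_refl.
  by apply: le_trans (P_N _) _; rewrite N_scale // nd mulr1.
- by rewrite le_max lexx orbT.
- move=> e me ne; have [[c ce hc] _] := P_sand (t *: d) me.
  have nc : c \notin cls v by apply: contra ne => cv; apply: cls_disjoint me cv ce.
  by have := Ht0 t tt0 c nc; move: hc; rewrite evZ; lra.
Qed.

(** A maximal functional norms [p - x], and the margin at [p] excludes those outside the class. The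
    minimum over a class is thus read off from a distance, which the isometry preserves. *)
Lemma deep_dist v x p t : maxi v -> Om x -> Om p -> 2 * N x + 1 <= t -> N p = t ->
  (forall e, e \in cls v -> ev e p = t) ->
  (forall e, maxi e -> e \notin cls v -> ev e p + (2 * N x + 1) <= t) ->
  forall e, e \in kmin v x -> N (p - x) = t - ev e x.
Proof.
move=> mv Ox Op Ct Np on off e /kminP[ec emin].
have hx := N_ge0 x.
have ge : t - ev e x <= N (p - x) by rewrite -(on e ec) -evB ev_le.
have ex := ev_le e x.
have [|c mc hc] := @norming p x Op Ox; first by rewrite gt_eqF //; lra.
apply/eqP; rewrite eq_le ge andbT -hc.
have [cv|cv] := boolP (c \in cls v).
  by rewrite evB on // lerB // emin.
have := off c mc cv; have := ev_ge c x; move: hc; rewrite evB; lra.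
Qed.

Lemma face_scale a d : 0 < a -> face (a *: d) = face d.
Proof.
move=> a0; apply/setP => e; rewrite !inE N_scale ?ltW // evZ.
by rewrite (inj_eq (mulfI _)) // gt_eqF.
Qed.

(** For [p] deep in the cone of [e], [f p] is deep in that of [v]. By [deep_dist] and isometry, [c]
    norms [f p - f x] and takes at [f x] the minimal value of the class of [e] at [x]. So [c] is
    controlled by the face of [p - x] and also by the class of [e]; [lin_inter] intersects the two,
    and the intersection is [kmin e x]. *)
Lemma kmin_step v e x : maxi v -> maxi e -> below v 1 e -> above v 1 e -> Om x ->
  forall c, c \in kmin v (f x) -> forall z, sand (ev c (f z)) (kmin e x) z.
Proof.
move=> mv me ve va Ox c cmin z; have /kminP[/clsP vc _] := cmin.
have mc : maxi c by apply: maxi_below vc.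
have [p [t [Op Np Ct on off]]] := deep_point (2 * N x + 1) me.
have Cfx : 2 * N (f x) + 1 <= t by rewrite OmN.
have back b g : maxi b -> below b 1 g -> above b 1 g -> g \in cls e -> b \in cls v.
  move=> mb bg ba /clsP eg; apply/clsP; apply: (@below_of_ba v 1 g) ba.
  exact: below_trans ve eg.
have forth b g : below v 0 b -> below b 1 g -> g \in cls e.
  move=> vb bg; apply/clsP; apply: (@below_of_ab v 1) va _.
  exact: below_trans vb bg.
have [a0 a0P] := kmin_exists e x.
have d1 := deep_dist me Ox Op Ct Np on off a0P.
have d2 : N (f p - f x) = t - ev c (f x).
  apply: (@deep_dist v) => //; [exact: Omf|exact: Omf|by rewrite OmN| |].
    move=> b /clsP vb; have -> : t = ev v (f p).
      by rewrite (va p) ?on ?cls_refl // Np ger0_norm // -Np N_ge0.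
    apply: vb; first exact: Omf.
    by rewrite /= (va p) ?on ?cls_refl // ?OmN // Np ger0_norm // -Np N_ge0.
  rewrite OmN // => b mb nb; have [d [ld gd]] := maxi_good mb.
  have [[g gF hg] _] := lin_sand p ld; have [mg bg ba] := gd g gF.
  have := off g mg; case: (boolP (g \in cls e)) => [ge|ge /(_ isT)]; last by lra.
  by case/negP: nb; apply: back bg ba ge.
have ac : ev c (f x) = ev a0 x.
  by move: d2; rewrite Om_iso // d1; lra.
have [u [nu Fu]] := maxi_expose me.
have [d [ld gd]] := maxi_good mc.
have lu : lin c u.
  split => // s; apply: sand_eq (lin_sand (s *: u) ld) _ => g gF.
  have [_ cg _] := gd g gF; have := forth c g vc cg; rewrite -Fu => /faceP hg.
  by rewrite evZ hg nu mulr1.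
have ev_c : ev c (f p - f x) = N (p - x).
  rewrite -Om_iso // d2 evB; congr (_ - _).
  have -> : t = ev v (f p) by rewrite (va p) ?on ?cls_refl // Np ger0_norm // -Np N_ge0.
  apply: vc; first exact: Omf.
  by rewrite /= (va p) ?on ?cls_refl // ?OmN // Np ger0_norm // -Np N_ge0.
have npx : 0 < N (p - x) by rewrite d1; have := ev_le a0 x; have := N_ge0 x; lra.
have Fpx : face ((N (p - x))^-1 *: (p - x)) = face (p - x).
  by rewrite face_scale // invr_gt0.
have val g : g \in cls e -> (g \in face (p - x)) = (ev g x == ev a0 x).
  by move=> ge; rewrite inE d1 evB on // (inj_eq (addrI _)) eqr_opp.
have [||g|d' [ld' Fd']] := @lin_inter c u ((N (p - x))^-1 *: (p - x)) x lu.
- by rewrite N_scale ?invr_ge0 ?N_ge0 // mulVf // gt_eqF.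
- by move=> w; rewrite Fpx; apply: horo; apply: iso_line; rewrite ev_c.
- by rewrite Fu Fpx => ge; rewrite val // ac => /eqP.
have -> : kmin e x = face d'; last exact: lin_sand.
rewrite Fd' Fu Fpx; apply/setP => g; rewrite [RHS]inE.
apply/kminP/andP => -[ge].
  move=> H; split => //; rewrite val //; have /kminP[a0e a0m] := a0P.
  by rewrite eq_le H ?a0m.
rewrite val // => /eqP ->; split => //; by have /kminP[] := a0P.
Qed.

Lemma maxi_next v : maxi v -> exists e, [/\ maxi e, below v 1 e & above v 1 e].
Proof.
move=> /maxi_good[d [_ gd]]; have [e ed] := face_neq0 d; exists e; exact: gd.
Qed.

Lemma kmin_iter v k x : maxi v -> Om x -> exists e, [/\ maxi e, below v k e, above v k e &
  forall c, c \in kmin v (iter k f x) -> forall z, sand (ev c (iter k f z)) (kmin e x) z].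
Proof.
move=> mv Ox; elim: k v mv => [|k IH] v mv.
  exists v; split => // c ck z; split; by exists c.
have [e [me ve va]] := maxi_next mv; have [g [mg eg ea H]] := IH e me.
exists g; split => //; rewrite -?[k.+1]addn1 1?addnC.
- exact: below_trans ve eg.
- exact: above_trans va ea.
move=> c ck z; rewrite addnC addn1 /= in ck *.
exact: sand_trans (kmin_step mv me ve va (Om_iter k Ox) ck _) (fun b bk => H b bk z).
Qed.

Lemma kmin_period v k x : maxi v -> Om x ->
  (below v k v /\ above v k v) ->
  forall c, c \in kmin v (iter k f x) -> forall z, sand (ev c (iter k f z)) (kmin v x) z.
Proof.
move=> mv Ox [vk va] c ck z; have [e [me ve ea H]] := kmin_iter k mv Ox.
by rewrite -(kmin_cls x mv (below_of_ab va ve)); apply: H.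
Qed.

(* By [kmin_period], the iterates of [f] near [P] keep the minimizers of [ev _ x]
   in the class apart from its maximizers. If these were disjoint, evaluating [P]
   at a point exposing the minimizers would separate functionals of one class. *)
Lemma agreement v e x : maxi v -> e \in cls v -> Om x -> ev e x = ev v x.
Proof.
move=> mv ec Ox; have mnv := maxi_neg mv.
have [per per0 perP] := maxi_period.
have [z [nz Fz]] : exists z, N z = 1 /\ face z = kmin v x.
  have [p [t [Op Np Ct on off]]] := deep_point (2 * N x + 1) mv.
  have [a0 a0P] := kmin_exists v x; have /kminP[a0v a0m] := a0P.
  have d1 := deep_dist mv Ox Op Ct Np on off a0P.
  have npx : 0 < N (p - x) by rewrite d1; have := ev_le a0 x; have := N_ge0 x; lra.
  have [u [nu Fu]] := maxi_expose mv.
  have val g : g \in cls v -> (g \in face (p - x)) = (ev g x == ev a0 x).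
    by move=> ge; rewrite inE d1 evB on // (inj_eq (addrI _)) eqr_opp.
  have [||z [nz Fz]] := @expose_inter u ((N (p - x))^-1 *: (p - x)) nu.
  - by rewrite N_scale ?invr_ge0 ?N_ge0 // mulVf // gt_eqF.
  - by exists a0; rewrite finset.in_setI Fu a0v face_scale ?invr_gt0 // val // eqxx.
  exists z; split => //; rewrite Fz Fu face_scale ?invr_gt0 //.
  apply/setP => g; rewrite finset.in_setI; apply/andP/kminP => -[ge].
    by rewrite val // => /eqP ->.
  by move=> H; rewrite val // eq_le H ?a0m.
have [c1 c1v h1] : exists2 c, c \in cls v & 1 <= ev c (P z).
  apply: fin_closed => eps e0; have [k [_ ok h _]] := P_approx z z e0 per0.
  have [c cP] := kmin_exists v (iter k f x).
  have := kmin_period mv Ox (perP k v ok mv) cP z.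
  move=> /sand_eq/(_ _)-/(_ 1) h1; exists c; first by have /kminP[] := cP.
  have <- : ev c (iter k f z) = 1.
    by apply: h1 => b; rewrite -Fz => /faceP ->.
  by have := ev_abs c (P z - iter k f z); rewrite evB ler_norml; lra.
have NP : N (P z) = 1.
  by apply/eqP; rewrite eq_le (le_trans h1 (ev_le _ _)) andbT -nz P_N.
have vP : ev v (P z) = 1.
  move/clsP: c1v => /mv.2 h; have e1 : ev c1 (P z) = 1.
    by apply/eqP; rewrite eq_le h1 andbT -NP ev_le.
  by rewrite -e1; apply: h => //=; rewrite e1 NP normr1.
have [c cB hc] : exists2 c, c \in kmin (neg v) x & 1 <= - ev c z.
  apply: fin_closed => eps e0; have [k [_ ok h _]] := P_approx z z e0 per0.
  have [c cP] := kmin_exists (neg v) (iter k f x).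
  have [_ [b bB hb]] := kmin_period mnv Ox (perP k _ ok mnv) cP z.
  exists b => //; have /kminP[/clsP cnv _] := cP.
  have : ev c (P z) = - 1.
    by rewrite cnv //= ev_neg vP // normrN normr1.
  by have := ev_abs c (P z - iter k f z); rewrite evB ler_norml; lra.
(* Besides being a minimizer, [neg c] is a maximizer of [ev _ x] on the class of [v], by the choice
   of [c]; all values therefore coincide. *)
have : neg c \in kmin v x.
  by rewrite -Fz; apply/faceP/eqP; rewrite eq_le ev_le nz ev_neg hc.
move=> /kminP[_ hmin]; move/kminP: cB => [_ hmax].
have val b : b \in cls v -> ev b x = - ev c x.
  move=> bv; apply/eqP; rewrite eq_le -ev_neg hmin // andbT ev_neg.
  have : neg b \in cls (neg v) by apply/clsP/below_neg/clsP.
  by move=> /hmax; rewrite ev_neg; lra.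
by rewrite (val e ec) (val v (cls_refl v)).
Qed.

Lemma P_agree v u : maxi v -> (forall e, e \in cls v -> ev e u = ev v u) ->
  ev v (P u) = ev v u.
Proof. by move=> mv H; apply: sand_eq (P_sand u mv) H. Qed.

(** * Equivariance and finite order on [Om] *)

Lemma equivariance v : maxi v ->
  exists e, [/\ maxi e, below v 1 e & forall x, Om x -> ev v (f x) = ev e x].
Proof.
move=> mv; have [d [ld gd]] := maxi_good mv; have [e ed] := face_neq0 d.
have [me ve va] := gd e ed; exists e; split => // x Ox.
apply: sand_eq (lin_sand x ld) _ => c /gd[_ vc _].
by apply: agreement => //; apply/clsP; apply: below_of_ab va vc.
Qed.

Lemma separated x y : Om x -> Om y -> (forall v, maxi v -> ev v x = ev v y) ->
  N (x - y) = 0.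
Proof.
move=> Ox Oy H; apply/eqP/negPn/negP => nz; have [v mv] := norming Ox Oy nz.
by rewrite evB H // subrr => /esym/eqP; rewrite (negPf nz).
Qed.

Lemma equivariance_iter k v : maxi v -> exists e, [/\ maxi e, below v k e &
  forall x, Om x -> ev v (iter k f x) = ev e x].
Proof.
elim: k v => [|k IH] v mv; first by exists v.
have [e [me ve He]] := equivariance mv; have [g [mg eg Hg]] := IH e me.
exists g; split => //; first by rewrite -addn1 addnC; apply: below_trans ve eg.
by move=> y Oy /=; rewrite He ?Hg //; apply: Om_iter.
Qed.

Lemma finite_order : exists2 per, (0 < per)%N & forall x, Om x -> N (iter per f x - x) = 0.
Proof.
have [per per0 perP] := maxi_period; exists per => // x Ox.
apply: separated => //; first exact: Om_iter.
move=> v mv; have [e [me ve ->]] := equivariance_iter per mv => //.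
have [_ va] := perP per v (dvdnn _) mv.
by apply: agreement => //; apply/clsP; exact: below_of_ab va ve.
Qed.

Lemma ev_of_N0 v x y : N (x - y) = 0 -> ev v x = ev v y.
Proof.
move=> h; apply/eqP; rewrite -subr_eq0 -evB -normr_le0 -h; exact: ev_abs.
Qed.

Lemma equivariance_inv v : maxi v ->
  exists2 e, maxi e & forall x, Om x -> ev e (f x) = ev v x.
Proof.
move=> mv; have [[//|per] _ perP] := finite_order.
have [e [me _ He]] := equivariance_iter per mv; exists e => // x Ox.
by rewrite -He; [apply: ev_of_N0; rewrite -iterSr; apply: perP|apply: Omf].
Qed.

(** * The sup norm *)

Lemma iter_separated k x : Om x ->
  (forall v, maxi v -> ev v (iter k f x) = ev v x) -> N (iter k f x - x) = 0.
Proof. by move=> Ox; apply: separated => //; apply: Om_iter. Qed.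

Section SignedCoordinates.
Variables (n : nat) (co : 'I_n -> X -> R) (idx : V -> 'I_n) (sg : V -> bool).
Hypothesis ev_co : forall v x, ev v x = (-1) ^+ sg v * co (idx v) x.

(** Coordinates are identified when they agree up to sign on [Om]. The order of the permutation of
    classes returns each maximal coordinate to itself up to sign, and doubling it removes the
    sign. *)
Lemma order_signed_coordinates :
  exists pi : 'S_n, forall x, Om x -> N (iter (2 * #[pi]%g) f x - x) = 0.
Proof.
pose E i := [exists v, `[< maxi v >] && (idx v == i)].
have EP i : E i -> exists2 v, maxi v & idx v = i.
  by move=> /existsP[v /andP[/asboolP mv /eqP]]; exists v.
have EI v : maxi v -> E (idx v).
  by move=> mv; apply/existsP; exists v; rewrite eqxx andbT; apply/asboolP.
have coE v x : co (idx v) x = (-1) ^+ sg v * ev v x.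
  by rewrite ev_co mulrA -signr_addb addbb mul1r.
pose eqv i j := exists b : bool, forall x, Om x -> co i x = (-1) ^+ b * co j x.
have /choice[rho rhoP] : forall i, exists j, E i -> E j /\
    exists b : bool, forall x, Om x -> co i (f x) = (-1) ^+ b * co j x.
  move=> i; have [/EP[v mv <-]|ne] := boolP (E i); last by exists i.
  have [e [me _ H]] := equivariance mv; exists (idx e) => _; split; first exact: EI.
  exists (sg v (+) sg e) => x Ox.
  by rewrite coE H // ev_co mulrA -signr_addb.
have sK (b : bool) (x : R) : (-1) ^+ b * ((-1) ^+ b * x) = x.
  by rewrite mulrA -signr_addb addbb mul1r.
have eqs i j : eqv i j -> eqv j i.
  by move=> [b H]; exists b => x Ox; rewrite H // sK.
have eqt i j k : eqv i j -> eqv j k -> eqv i k.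
  by move=> [b H] [c H']; exists (b (+) c) => x Ox; rewrite H // H' // signr_addb mulrA.
have [|i Ei|i j Ei Ej|pi piP] := @perm_of_classes n E eqv rho _ eqs eqt.
- by move=> i; exists false => x _; rewrite mul1r.
- by have [] := rhoP i Ei.
- have [_ [b Hb]] := rhoP i Ei; have [_ [c Hc]] := rhoP j Ej; split=> [[a Ha]|[a Ha]].
    exists (b (+) a (+) c) => x Ox.
    by rewrite -[LHS](sK b) -Hb // Ha ?Hc ?signr_addb ?mulrA //; apply: Omf.
  exists (b (+) a (+) c) => x Ox; have [y Oy <-] := Om_surj Ox.
  by rewrite Hb // Ha // -[co (rho j) y](sK c) -Hc // !signr_addb !mulrA.
exists pi => x Ox; apply: iter_separated => // v mv.
have iterP k i : E i -> E (iter k rho i) /\ exists b : bool,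
    forall x, Om x -> co i (iter k f x) = (-1) ^+ b * co (iter k rho i) x.
  move=> Ei; elim: k => [|k [Ek [b IH]]] /=.
    by split => //; exists false => y _; rewrite mul1r.
  have [Er [c Hc]] := rhoP _ Ek; split => //; exists (b (+) c) => y Oy.
  by rewrite -iterS iterSr IH ?Hc ?signr_addb ?mulrA //; apply: Omf.
have [_ [b Hb]] := iterP #[pi]%g _ (EI v mv).
have [c Hc] := piP _ (EI v mv).
rewrite !ev_co mulSn mul1n iterD Hb; last exact: Om_iter.
rewrite Hc; last exact: Om_iter.
by rewrite Hb // Hc // [(-1) ^+ c * ((-1) ^+ b * _)]mulrCA !sK.
Qed.
End SignedCoordinates.

(** * The 1-norm *)

Lemma P_nonexp x y : N (P x - P y) <= N (x - y).
Proof.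
apply/ler_addgt0Pr => eps e0; have e20 : 0 < eps / 2 by lra.
have [k [_ _ hx hy]] := P_approx x y e20 (ltn0Sn 0).
apply: le_trans (N_dist (iter k f x) _ _) _.
have := N_dist (iter k f y) (iter k f x) (P y); have := iter_f_le k x y.
rewrite (N_sub (iter k f y)); lra.
Qed.

Section SumOfCoordinates.
Variables (n : nat) (co : 'I_n -> {scalar X}) (sg : V -> 'I_n -> bool).
Hypothesis ev_sum : forall v x, ev v x = \sum_i (-1) ^+ sg v i * co i x.
Hypothesis N_sum : forall x, N x = \sum_i `|co i x|.
Implicit Types i j : 'I_n.

Lemma co_le i x : `|co i x| <= N x.
Proof. by rewrite N_sum (bigD1 i) //= lerDl sumr_ge0. Qed.

(* On [Uc] the functionals of each class agree, so that [P] maps [Uc] onto [Om]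
   without changing their values: [Om] is parametrized by the linear space [Uc],
   and [pcoord i] is the [i]-th coordinate in this parametrization. *)
Definition Uc x := forall v e, maxi v -> e \in cls v -> ev e x = ev v x.
Definition pcoord i u : R := co i (P u).
Definition ev_equal x y := forall v, maxi v -> ev v x = ev v y.

Lemma Uc_Om x : Om x -> Uc x.
Proof. by move=> Ox v e mv ve; apply: agreement. Qed.

Lemma UcD x y : Uc x -> Uc y -> Uc (x + y).
Proof. by move=> Ux Uy v e mv ve; rewrite !evD (Ux v e) // (Uy v e). Qed.

Lemma UcZ a x : Uc x -> Uc (a *: x).
Proof. by move=> Ux v e mv ve; rewrite !evZ (Ux v e). Qed.

Lemma UcN x : Uc x -> Uc (- x).
Proof. by rewrite -scaleN1r; apply: UcZ. Qed.

Lemma UcB x y : Uc x -> Uc y -> Uc (x - y).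
Proof. by move=> Ux Uy; apply: UcD => //; apply: UcN. Qed.

Lemma ev_P v u : maxi v -> Uc u -> ev v (P u) = ev v u.
Proof. by move=> mv Uu; apply: P_agree => // e; apply: Uu. Qed.

Lemma pcoord_ev_equal i x y : Uc x -> Uc y -> ev_equal x y -> pcoord i x = pcoord i y.
Proof.
move=> Ux Uy xy; apply/eqP; rewrite -subr_eq0 -normr_le0 -linearB.
apply: le_trans (co_le _ _) _; rewrite separated //.
by move=> v mv; rewrite !ev_P // xy.
Qed.

Lemma pcoord_lip i x y : `|pcoord i x - pcoord i y| <= N (x - y).
Proof. by rewrite -linearB; apply: le_trans (co_le _ _) _; apply: P_nonexp. Qed.

Lemma pcoord0 i : pcoord i 0 = 0.
Proof.
apply/eqP; rewrite -normr_le0; apply: le_trans (co_le _ _) _.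
by have := P_N 0; rewrite N0.
Qed.

Lemma pcoord_Om i x : Om x -> pcoord i x = co i x.
Proof.
move=> Ox; apply/eqP; rewrite -subr_eq0 -normr_le0 -linearB.
apply: le_trans (co_le _ _) _; rewrite separated // => v mv.
by apply: ev_P => //; apply: Uc_Om.
Qed.

(** * Directions of monotonicity of the coordinates *)

Definition top v d := maxi v /\ forall e, maxi e -> ev e d <= ev v d.

(** No maximal functional is larger than [v] at [d], so by [norming] and [ev_P] it is [v] that norms
    [P (u + d) - P u]. For a sum of absolute values this forces each signed coordinate of the
    difference to be nonnegative. *)
Lemma top_mono v d u i : top v d -> Uc d -> Uc u ->
  0 <= (-1) ^+ sg v i * (pcoord i (u + d) - pcoord i u).
Proof.
move=> [mv td] Ud Uu; set y := P (u + d) - P u.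
have Uud := UcD Uu Ud.
have vy : ev v y = N y.
  have [y0|y0] := eqVneq (N y) 0.
    by apply/eqP; rewrite y0 -normr_le0 -y0 ev_abs.
  have [e me he] := norming (OmP (u + d)) (OmP u) y0.
  apply/eqP; rewrite eq_le ev_le /= -he /y !evB !ev_P // !evD addrAC subrr add0r.
  by rewrite addrAC subrr add0r td.
rewrite -linearB -/y; move/eqP: vy; rewrite eq_sym ev_sum N_sum -subr_eq0 -sumrB.
rewrite psumr_eq0 => [/allP/(_ i)|j _]; last first.
  by rewrite subr_ge0; apply: le_trans (ler_norm _) _; rewrite normrM normrX normrN1 expr1n mul1r.
by rewrite mem_index_enum => /(_ isT)/implyP/(_ isT); rewrite subr_eq0 => /eqP <-.
Qed.

Definition up i d := forall u, Uc u -> pcoord i u <= pcoord i (u + d).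
Definition dn i d := forall u, Uc u -> pcoord i (u + d) <= pcoord i u.
Definition hyp i d := forall u, Uc u -> pcoord i (u + d) = pcoord i u.

Lemma hyp_up_dn i d : up i d -> dn i d -> hyp i d.
Proof. by move=> h h' u Uu; apply/eqP; rewrite eq_le h // h'. Qed.

Lemma hyp_up i d : hyp i d -> up i d.
Proof. by move=> h u Uu; rewrite h. Qed.

Lemma hyp_dn i d : hyp i d -> dn i d.
Proof. by move=> h u Uu; rewrite h. Qed.

Lemma top_up v d i : top v d -> Uc d -> sg v i = false -> up i d.
Proof.
move=> tv Ud sv u Uu; have := top_mono i tv Ud Uu.
by rewrite sv mul1r subr_ge0.
Qed.

Lemma top_dn v d i : top v d -> Uc d -> sg v i = true -> dn i d.
Proof.
move=> tv Ud sv u Uu; have := top_mono i tv Ud Uu.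
by rewrite sv expr1 mulN1r oppr_ge0 subr_le0.
Qed.

Lemma topZ v d a : 0 <= a -> top v d -> top v (a *: d).
Proof. by move=> a0 [mv td]; split => // e me; rewrite !evZ ler_wpM2l ?td. Qed.

Lemma upD i d d' : Uc d -> up i d -> up i d' -> up i (d + d').
Proof.
move=> Ud h h' u Uu; rewrite addrA; apply: le_trans (h u Uu) _; apply: h'; exact: UcD.
Qed.

Lemma hypD i d d' : Uc d -> hyp i d -> hyp i d' -> hyp i (d + d').
Proof. by move=> Ud h h' u Uu; rewrite addrA h' ?h //; apply: UcD. Qed.

Lemma dn_opp i d : Uc d -> dn i (- d) -> up i d.
Proof.
by move=> Ud h u Uu; have := h (u + d) (UcD Uu Ud); rewrite addrK.
Qed.

Lemma up_opp i d : Uc d -> up i (- d) -> dn i d.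
Proof.
by move=> Ud h u Uu; have := h (u + d) (UcD Uu Ud); rewrite addrK.
Qed.

Lemma hypN i d : Uc d -> hyp i d -> hyp i (- d).
Proof.
move=> Ud h u Uu; have := h (u - d) (UcB Uu Ud); by rewrite subrK => ->.
Qed.

Lemma hyp_ev_equal i d d' : Uc d -> Uc d' -> ev_equal d d' -> hyp i d -> hyp i d'.
Proof.
move=> Ud Ud' dd h u Uu; rewrite -(h u Uu); apply: pcoord_ev_equal; [exact: UcD|exact: UcD|].
by move=> v mv; rewrite !evD dd.
Qed.

Lemma up_ev_equal i d d' : Uc d -> Uc d' -> ev_equal d d' -> up i d -> up i d'.
Proof.
move=> Ud Ud' dd h u Uu; apply: le_trans (h u Uu) _; rewrite le_eqVlt; apply/orP; left.
apply/eqP; apply: pcoord_ev_equal; [exact: UcD|exact: UcD|].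
by move=> v mv; rewrite !evD dd.
Qed.

Lemma up_closed i d d' : Uc d -> Uc d' ->
  (forall eps : R, 0 < eps -> exists2 t, `|t| <= eps & up i (d + t *: d')) -> up i d.
Proof.
move=> Ud Ud' H u Uu; apply/ler_addgt0Pr => eps e0.
have Nd := N_ge0 d'; have c0 : 0 < N d' + 1 by lra.
have [|t te ht] := H (eps / (N d' + 1)); first by rewrite divr_gt0.
apply: le_trans (ht u Uu) _; rewrite -lerBlDl; apply: le_trans (ler_norm _) _.
apply: le_trans (pcoord_lip _ _ _) _.
have -> : u + (d + t *: d') - (u + d) = t *: d'.
  by rewrite opprD addrACA subrr add0r addrAC subrr add0r.
have : N (t *: d') <= `|t| * N d'.
  have [t0|t0] := leP 0 t; first by rewrite N_scale // ger0_norm.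
  by rewrite ltr0_norm // -N_opp -scaleNr N_scale // oppr_ge0 ltW.
move=> /le_trans; apply.
move: te; rewrite ler_pdivlMr // => te; apply: le_trans te; apply: ler_wpM2l => //; lra.
Qed.

Variable v0 : V.
Hypothesis maxi_v0 : maxi v0.

Lemma top_exists d : exists v, top v d.
Proof.
pose A : {set V} := [set v | `[< maxi v >]]%SET.
have AP v : reflect (maxi v) (v \in A) by rewrite /A inE; apply: asboolP.
case: (arg_maxP (fun v => ev v d) (introT (AP v0) maxi_v0)) => v /AP mv H.
by exists v; split => // e /AP; apply: H.
Qed.

Lemma up_or_dn i d : Uc d -> up i d \/ dn i d.
Proof.
move=> Ud; have [v tv] := top_exists d; case sv : (sg v i); [right|left].
  exact: top_dn sv.
exact: top_up sv.
Qed.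

(** The coordinate is monotone along [d] and unchanged by natural multiples of [d], hence unchanged
    by every nonnegative real multiple, squeezed between 0 and a natural one. *)
Lemma hypZ i a d : Uc d -> hyp i d -> hyp i (a *: d).
Proof.
have pos b c : 0 <= b -> Uc c -> hyp i c -> hyp i (b *: c).
  move=> b0 Uc_c h.
  have [m bm] : exists m : nat, b <= m%:R.
    by exists (Num.truncn b).+1; apply/ltW/truncnS_gt.
  have hm k : hyp i (k%:R *: c).
    elim: k => [|k IH]; first by rewrite scale0r => u Uu; rewrite addr0.
    by rewrite mulrSr scalerDl scale1r; apply: hypD => //; apply: UcZ.
  have mb0 : 0 <= m%:R - b by rewrite subr_ge0.
  have [v tv] := top_exists c; case sv : (sg v i).
    have h1 := top_dn (topZ b0 tv) (UcZ b Uc_c) sv.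
    have h2 := top_dn (topZ mb0 tv) (UcZ _ Uc_c) sv.
    apply: hyp_up_dn => // u Uu; rewrite -{1}(hm m u Uu).
    have := h2 (u + b *: c) (UcD Uu (UcZ b Uc_c)).
    by rewrite -addrA -scalerDl [b + _]addrC subrK.
  have h1 := top_up (topZ b0 tv) (UcZ b Uc_c) sv.
  have h2 := top_up (topZ mb0 tv) (UcZ _ Uc_c) sv.
  apply: hyp_up_dn => // u Uu; rewrite -(hm m u Uu).
  have := h2 (u + b *: c) (UcD Uu (UcZ b Uc_c)).
  by rewrite -addrA -scalerDl [b + _]addrC subrK.
move=> Ud h; have [a0|a0] := leP 0 a; first exact: pos.
rewrite -[a]opprK scaleNr -scalerN; apply: pos; [lra|exact: UcN|exact: hypN].
Qed.

Lemma upZ i a d : 0 <= a -> Uc d -> up i d -> up i (a *: d).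
Proof.
move=> a0 Ud h; have [v tv] := top_exists d; case sv : (sg v i).
  apply: hyp_up; apply: hypZ => //; apply: hyp_up_dn => //; exact: top_dn sv.
exact: top_up (topZ a0 tv) (UcZ a Ud) sv.
Qed.

(* [w - c d0] increases the coordinate for [c] small and decreases it for [c]
   large; it lies in [hyp i] for the critical value of [c]. *)
Lemma hyp_hyperplane i d0 w : Uc d0 -> up i d0 -> ~ hyp i d0 -> Uc w ->
  exists c, hyp i (w - c *: d0).
Proof.
move=> Ud0 upd nd Uw; pose S := [set c | up i (w - c *: d0)].
have Uwc c : Uc (w - c *: d0) by apply: UcB => //; apply: UcZ.
have notdn : ~ dn i d0 by move=> h; apply: nd; apply: hyp_up_dn.
(* If [S] were empty, [w + eps^-1 *: d0] would satisfy [dn i] for all [eps > 0]; scaled by [eps] it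
   tends to [d0], against [notdn]. The upper bound of [S] is obtained symmetrically. *)
have S0 : S !=set0.
  apply/set0P/negP => /eqP S0; apply: notdn; apply: up_opp => //.
  apply: (@up_closed i _ (- w)); [exact: UcN|exact: UcN|] => eps e0; exists eps.
    by rewrite gtr0_norm.
  have : dn i (w - (- eps^-1) *: d0).
    have [h|//] := up_or_dn i (Uwc (- eps^-1)).
    by suff : set0 (- eps^-1) by []; rewrite -S0.
  rewrite -{1}[w - _]opprK => /(dn_opp (UcN (Uwc _))) h.
  have -> : - d0 + eps *: - w = eps *: - (w - - eps^-1 *: d0).
    by rewrite opprD opprK scalerDr scalerA mulrN mulfV ?gt_eqF // scaleN1r addrC.
  apply: upZ => //; [exact: ltW|exact: UcN].
have downS c c' : c' <= c -> S c -> S c'.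
  move=> cc h; rewrite /S /=.
  have -> : w - c' *: d0 = (w - c *: d0) + (c - c') *: d0.
    by rewrite scalerBl addrA subrK.
  by apply: upD => //; apply: upZ => //; rewrite subr_ge0.
have Sub : has_ubound S.
  apply/not_existsP => nub; apply: notdn; apply: up_opp => //.
  apply: (@up_closed i _ w) => //; first exact: UcN.
  move=> eps e0; exists eps; first by rewrite gtr0_norm.
  have /existsNP[c /not_implyP[Sc /negP]] := nub eps^-1; rewrite -ltNge => ce.
  have h := downS _ _ (ltW ce) Sc.
  have -> : - d0 + eps *: w = eps *: (w - eps^-1 *: d0).
    by rewrite scalerBr scalerA mulfV ?gt_eqF // scale1r addrC.
  by apply: upZ => //; exact: ltW.
exists (sup S); apply: hyp_up_dn.
  apply: (@up_closed i _ d0) => // eps e0.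
  have [c Sc lc] := sup_adherent e0 (conj S0 Sub).
  exists eps; first by rewrite gtr0_norm.
  have -> : w - sup S *: d0 + eps *: d0 = w - (sup S - eps) *: d0.
    by rewrite scalerBl opprB addrA addrAC.
  by apply: downS Sc; exact: ltW.
apply: up_opp => //; apply: (@up_closed i _ d0) => // [|eps e0]; first exact: UcN.
exists eps; first by rewrite gtr0_norm.
have -> : - (w - sup S *: d0) + eps *: d0 = - (w - (sup S + eps) *: d0).
  by rewrite !opprB scalerDl addrAC.
apply: dn_opp; first exact: UcN.
rewrite opprK; have [h|//] := up_or_dn i (Uwc (sup S + eps)).
have : sup S + eps <= sup S by apply: ub_le_sup.
by rewrite gerDl leNgt e0.
Qed.

Definition movable i := exists2 d, Uc d & ~ hyp i d.

Lemma not_movable i d : ~ movable i -> Uc d -> pcoord i d = 0.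
Proof.
move=> nE Ud; have h : hyp i d by apply: contrapT => nd; apply: nE; exists d.
rewrite -[d]add0r h ?pcoord0 // => v e _ _; by rewrite !ev0.
Qed.

Lemma movable_up i : movable i -> exists d, [/\ Uc d, up i d & ~ dn i d].
Proof.
move=> [d Ud nd]; have [h|h] := up_or_dn i Ud.
  by exists d; split => // h'; apply: nd; apply: hyp_up_dn.
have h2 : up i (- d) by apply: dn_opp; [exact: UcN|rewrite opprK].
exists (- d); split => // [|h3]; first exact: UcN.
by apply: nd; apply: hyp_up_dn h; apply: dn_opp.
Qed.

Lemma top_limit i b d d' :
  (forall t, 0 < t -> exists2 v, top v (d + t *: d') & sg v i = b) ->
  exists2 v, top v d & sg v i = b.
Proof.
move=> H; pose A : {set V} := [set v | `[< maxi v /\ sg v i = b >]]%SET.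
have AP v : reflect (maxi v /\ sg v i = b) (v \in A) by rewrite /A inE; apply: asboolP.
have [w [mw tw]] := top_exists d.
have [|v /AP[mv vb] hv] := @fin_closed R V A (fun v => ev v d) (ev w d).
  move=> eps e0; have Nd := N_ge0 d'; have c0 : 0 < 2 * N d' + 1 by lra.
  pose t := eps / (2 * N d' + 1); have t0 : 0 < t by rewrite divr_gt0.
  have te : t * (2 * N d' + 1) = eps by rewrite divfK // gt_eqF.
  have [v [mv tv] vb] := H t t0; exists v; first exact/AP.
  have := tv w mw; rewrite !evE.
  have a1 : t * ev v d' <= t * N d' by rewrite ler_wpM2l ?ev_le // ltW.
  have a2 : t * - N d' <= t * ev w d' by rewrite ler_wpM2l ?ev_ge // ltW.
  by lra.
exists v => //; split => // e me; exact: le_trans (tw e me) hv.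
Qed.

Lemma up_pos i t d : 0 < t -> Uc d -> up i (t *: d) -> up i d.
Proof.
move=> t0 Ud h; rewrite -[d](scalerK (lt0r_neq0 t0)).
by apply: upZ => //; [rewrite invr_ge0 ltW|exact: UcZ].
Qed.

(** Perturbed by a small multiple of [d0] or [- d0], the direction [d] becomes monotone in one sense
    only, which prescribes the sign of the [i]-th coordinate in a top functional. As [V] is finite,
    the perturbation can tend to 0. *)
Lemma hyp_top i d b : movable i -> Uc d -> hyp i d -> exists2 v, top v d & sg v i = b.
Proof.
move=> /movable_up[d0 [Ud0 upd ndn]] Ud h.
apply: (@top_limit i b d (if b then - d0 else d0)) => t t0.
have [v tv] := top_exists (d + t *: (if b then - d0 else d0)); exists v => //.
case: b tv => tv; case sv : (sg v i) => //; exfalso; apply: ndn.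
  have h1 := top_up tv (UcD Ud (UcZ t (UcN Ud0))) sv.
  apply: up_opp => //; apply: (up_pos t0 (UcN Ud0)) => u Uu.
  by apply: le_trans (h1 u Uu) _; rewrite addrCA addrC h //; apply: UcD => //; apply/UcZ/UcN.
have h1 := top_dn tv (UcD Ud (UcZ t Ud0)) sv.
apply: up_opp => //; apply: (up_pos t0 (UcN Ud0)).
rewrite scalerN; apply: dn_opp; first exact/UcN/UcZ.
rewrite opprK => u Uu; apply: le_trans (h1 u Uu).
by rewrite addrCA addrC h //; apply: UcD => //; apply/UcZ.
Qed.

Lemma two_tops v v' d i : top v d -> top v' d -> Uc d -> sg v i != sg v' i -> hyp i d.
Proof.
move=> tv tv' Ud; case sv : (sg v i); case sv' : (sg v' i) => // _; apply: hyp_up_dn;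
  solve [exact: top_up tv' Ud sv' | exact: top_dn tv Ud sv | exact: top_up tv Ud sv | exact: top_dn tv' Ud sv'].
Qed.

(* The cone of a class has interior points, so that a coordinate which is
   monotone in both senses along that cone is constant. *)
Lemma class_sign v v' i : maxi v -> maxi v' -> movable i ->
  (forall x, Om x -> ev v x = ev v' x) -> sg v i = sg v' i.
Proof.
move=> mv mv' [w Uw nw] vv; apply/eqP/negPn/negP => sv; apply: nw.
have cv' : v' \in cls v by apply/clsP => x Ox _; rewrite vv.
have [p [t [Op Np _ on off]]] := deep_point (2 * N w) mv.
have Up := Uc_Om Op.
have tops u : Uc u -> N u <= N w -> forall e, e \in cls v -> top e (p + u).
  move=> Uu uw e ec; have me := maxi_cls mv ec; split => // c mc.
  rewrite !evD (on e ec) (Uu v e) //; have [cc|cc] := boolP (c \in cls v).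
    by rewrite (on c cc) (Uu v c).
  have := off c mc cc; have := ev_le c u; have := ev_ge v u; lra.
have hu u : Uc u -> N u <= N w -> hyp i (p + u).
  move=> Uu uw; apply: two_tops (tops u Uu uw v (cls_refl v)) (tops u Uu uw v' cv') _ sv.
  exact: UcD.
have U0 : Uc 0 by move=> e c _ _; rewrite !ev0.
have h0 := hu 0 U0; rewrite addr0 N0 in h0.
have -> : w = - p + (p + w) by rewrite addKr.
apply: hypD; [exact: UcN|apply: hypN => //; apply: h0; exact: N_ge0|exact: hu].
Qed.

(** The locus where the maximum of the maximal functionals is not smooth. By the next two lemmas, on
    [Uc] it is the union of the [hyp i] with [i] movable. *)
Definition crease d := exists v v', [/\ top v d, top v' d &
  exists2 x, Om x & ev v x != ev v' x].

Lemma hyp_crease i d : movable i -> Uc d -> hyp i d -> crease d.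
Proof.
move=> Ei Ud h; have [v tv sv] := hyp_top true Ei Ud h.
have [v' tv' sv'] := hyp_top false Ei Ud h.
exists v, v'; split => //; apply/not_exists2P => nex.
have : sg v i = sg v' i.
  apply: class_sign => //; [by case: tv|by case: tv'|move=> x Ox].
  by have [//|/negP] := nex x; move/negPn/eqP.
by rewrite sv sv'.
Qed.

Lemma crease_hyp d : Uc d -> crease d -> exists2 i, movable i & hyp i d.
Proof.
move=> Ud [v [v' [tv tv' [x Ox vv]]]]; apply/not_exists2P => nex.
case/eqP: vv; rewrite !ev_sum; apply: eq_bigr => i _.
have [Ei|nEi] := pselect (movable i).
  have [sv|sv] := eqVneq (sg v i) (sg v' i); first by rewrite sv.
  by have [//|nh] := nex i; case: nh; apply: two_tops sv.
by rewrite -pcoord_Om // (not_movable nEi) ?mulr0 //; apply: Uc_Om.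
Qed.

(** * The linear action of the iterates on [Uc], up to [ev_equal] *)

Definition tau k d := iter k f (P d).

Lemma Om_tau k d : Om (tau k d).
Proof. exact: Om_iter. Qed.

Lemma Uc_tau k d : Uc (tau k d).
Proof. exact/Uc_Om/Om_tau. Qed.

Lemma ev_tau k v : maxi v -> exists e, [/\ maxi e,
  forall x, Om x -> ev v (iter k f x) = ev e x &
  forall d, Uc d -> ev v (tau k d) = ev e d].
Proof.
move=> mv; have [e [me _ He]] := equivariance_iter k mv; exists e; split => // d Ud.
by rewrite /tau He // ev_P.
Qed.

Lemma tau_lin k a d d' : Uc d -> Uc d' ->
  ev_equal (tau k (d + a *: d')) (tau k d + a *: tau k d').
Proof.
move=> Ud Ud' v mv; have [e [me _ He]] := ev_tau k mv.
by rewrite !evD !evZ !He ?evD ?evZ //; apply: UcD => //; apply: UcZ.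
Qed.

Lemma tau_tau k l d : Uc d -> ev_equal (tau k (tau l d)) (tau (k + l) d).
Proof.
move=> Ud v mv; have [e [me Ho He]] := ev_tau k mv.
have -> : tau (k + l) d = iter k f (tau l d) by rewrite /tau iterD.
by rewrite Ho ?(He (tau l d)) //; [exact: Uc_tau|exact: Om_tau].
Qed.

Lemma tau1_surj y : Uc y -> exists2 x, Uc x & ev_equal (tau 1 x) y.
Proof.
move=> Uy; have [x Ox fx] := Om_surj (OmP y); exists x; first exact: Uc_Om.
move=> v mv; have [e [me Ho He]] := ev_tau 1 mv.
by rewrite He; [rewrite -Ho //= fx ev_P|exact: Uc_Om].
Qed.

Lemma tau1_crease d : Uc d -> crease d -> crease (tau 1 d).
Proof.
have tops v : Uc d -> top v d -> exists e, top e (tau 1 d) /\ forall x, Om x -> ev e (f x) = ev v x.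
  move=> Ud [mv tv]; have [e me He] := equivariance_inv mv; exists e; split => //.
  split => // c mc; have [g [mg _ Hg]] := ev_tau 1 mc; rewrite Hg //.
  by rewrite /tau /= He // ev_P // tv.
move=> Ud [v [v' [tv tv' [x Ox vv]]]].
have [e [te He]] := tops v Ud tv; have [e' [te' He']] := tops v' Ud tv'.
by exists e, e'; split => //; exists (f x); rewrite ?He ?He' //; apply: Omf.
Qed.

(* The hyperplanes [hyp i] cover the points lying in two distinct cones; this set is
   preserved by [tau 1], and a linear space covered by finitely many subspaces is
   contained in one of them. *)
Lemma tau1_hyp i : movable i -> exists j, movable j /\
  forall d, Uc d -> (hyp i d <-> hyp j (tau 1 d)).
Proof.
move=> Ei; pose W d := Uc d /\ hyp i d; pose Q j d := hyp j (tau 1 d).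
have U0 : Uc 0 by move=> e c _ _; rewrite !ev0.
have [||||||j] := @subspace_cover R X _ W Q [seq j <- enum 'I_n | `[< movable j >]].
- by split => // u Uu; rewrite addr0.
- by move=> a b [Ua ha] [Ub hb]; split; [exact: UcD|exact: hypD].
- by move=> t a [Ua ha]; split; [exact: UcZ|exact: hypZ].
- move=> j a b [Ua _] [Ub _] qa qb; have := tau_lin 1 1 Ua Ub; rewrite !scale1r => tl.
  apply: (@hyp_ev_equal _ (tau 1 a + tau 1 b)); [apply: UcD; exact: Uc_tau|exact: Uc_tau| |].
    by move=> v mv; rewrite tl.
  by apply: hypD => //; apply: Uc_tau.
- move=> j t a [Ua _] qa; have := tau_lin 1 t U0 Ua; rewrite add0r => tl.
  apply: (@hyp_ev_equal _ (t *: tau 1 a)); [apply: UcZ; exact: Uc_tau|exact: Uc_tau| |].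
    move=> v mv; rewrite tl // evD; have [e [me _ He]] := ev_tau 1 mv.
    by rewrite (He 0) // ev0 add0r.
  by apply: hypZ => //; apply: Uc_tau.
- move=> d [Ud hd]; have [j Ej hj] := crease_hyp (Uc_tau 1 d) (tau1_crease Ud (hyp_crease Ei Ud hd)).
  by exists j => //; rewrite mem_filter mem_enum andbT; apply/asboolP.
rewrite mem_filter => /andP[/asboolP Ej _] sub; exists j; split => // d Ud; split => [hd|hd].
  exact: sub.
(* Otherwise [hyp j] would contain the images of the hyperplane [hyp i] and of a direction outside
   it, hence everything, as [tau 1] is onto; but [j] is movable. *)
apply: contrapT => nh; have [d1 Ud1 nd1] := Ej; apply: nd1.
have [d2 [Ud2 upd2 nd2 d2d]] : exists d2, [/\ Uc d2, up i d2, ~ hyp i d2 & d2 = d \/ d2 = - d].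
  have [h|h] := up_or_dn i Ud; first by exists d; split => //; left.
  exists (- d); split; [exact: UcN| |move=> h'|by right].
    by apply: dn_opp; [exact: UcN|rewrite opprK].
  by apply: nh; rewrite -[d]opprK; apply: hypN => //; apply: UcN.
have hd2 : hyp j (tau 1 d2).
  case: d2d => -> //; apply: (@hyp_ev_equal _ (- tau 1 d)); [exact/UcN/Uc_tau|exact: Uc_tau| |].
    move=> v mv; have [e [me _ He]] := ev_tau 1 mv.
    by rewrite evN !He ?evN //; apply: UcN.
  by apply: hypN => //; apply: Uc_tau.
have [x Ux xd1] := tau1_surj Ud1.
have [c hc] := hyp_hyperplane Ud2 upd2 nd2 Ux.
have Uc2 : Uc (x - c *: d2) by apply: UcB => //; apply: UcZ.
apply: hyp_ev_equal xd1 _ => //; first exact: Uc_tau.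
apply: (@hyp_ev_equal _ (tau 1 (x - c *: d2) + c *: tau 1 d2)).
- by apply: UcD; [exact: Uc_tau|apply: UcZ; exact: Uc_tau].
- exact: Uc_tau.
- by move=> v mv; have := tau_lin 1 c Uc2 Ud2 mv; rewrite subrK => ->.
- by apply: hypD; [exact: Uc_tau|exact: sub|apply: hypZ => //; exact: Uc_tau].
Qed.

Lemma hyp_return : exists pi : 'S_n, forall i, movable i -> forall d, Uc d ->
  (hyp i d <-> hyp i (tau #[pi]%g d)).
Proof.
pose eqv i j := forall d, Uc d -> (hyp i d <-> hyp j d).
have /choice[rho rhoP] : forall i, exists j, movable i -> movable j /\
    forall d, Uc d -> (hyp i d <-> hyp j (tau 1 d)).
  by move=> i; have [/tau1_hyp[j H]|nE] := pselect (movable i); [exists j|exists i].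
have [|||i /asboolP Ei|i j /asboolP Ei /asboolP Ej|pi piP] :=
    @perm_of_classes n (fun i => `[< movable i >]) eqv rho.
- by move=> i d.
- by move=> i j ij d Ud; rewrite (ij d Ud).
- by move=> i j k ij jk d Ud; rewrite (ij d Ud) (jk d Ud).
- by apply/asboolP; have [] := rhoP i Ei.
- have [_ Hi] := rhoP i Ei; have [_ Hj] := rhoP j Ej; split => ij d Ud.
    have [x Ux xd] := tau1_surj Ud; have dx : ev_equal d (tau 1 x) by move=> v mv; rewrite xd.
    have tr k : hyp k d <-> hyp k (tau 1 x).
      by split; apply: hyp_ev_equal => //; apply: Uc_tau.
    by rewrite !tr -Hi // -Hj // ij.
  by rewrite Hi // Hj // ij //; apply: Uc_tau.
exists pi => i Ei d Ud.
have iterP k : movable (iter k rho i) /\ (hyp i d <-> hyp (iter k rho i) (tau k d)).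
  elim: k => [|k [Ek IH]] /=.
    split => //; split; apply: hyp_ev_equal => //; try exact: (Uc_tau 0).
      by move=> v mv; rewrite /tau /= ev_P.
    by move=> v mv; rewrite /tau /= ev_P.
  have [Er Hr] := rhoP _ Ek; split => //.
  rewrite -[f (tau k d)]/(tau k.+1 d) IH Hr; last exact: Uc_tau.
  have t1k := tau_tau 1 k Ud; rewrite add1n in t1k.
  split; apply: hyp_ev_equal; try exact: Uc_tau; first exact: t1k.
  by move=> v mv; rewrite (t1k v mv).
have [_ ->] := iterP #[pi]%g; apply: piP; [exact/asboolP|exact: Uc_tau].
Qed.

(** After [m] steps each hyperplane is back, and the quotient line is multiplied by some [kap].
    After [2 * m] steps the factor is a square, so directions of increase are preserved, hence the
    signs of coordinates and every maximal cone; [agreement] concludes. *)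
Lemma order_sum_of_coordinates :
  exists pi : 'S_n, forall x, Om x -> N (iter (2 * #[pi]%g) f x - x) = 0.
Proof.
have [pi Hpi] := hyp_return; exists pi; set m := #[pi]%g.
have up2 i d : movable i -> Uc d -> up i d -> up i (tau (2 * m) d).
  move=> Ei Ud upd; have Hm := Hpi i Ei; have [d0 [Ud0 upd0 ndn0]] := movable_up Ei.
  have nd0 : ~ hyp i d0 by move=> /hyp_dn.
  have [c hc] := hyp_hyperplane Ud0 upd0 nd0 Ud.
  have [kap hk] := hyp_hyperplane Ud0 upd0 nd0 (Uc_tau m d0).
  have step y b : Uc y -> hyp i (y - b *: d0) -> hyp i (tau m y - (b * kap) *: d0).
    move=> Uy h; have Uyb : Uc (y - b *: d0) by apply: UcB => //; apply: UcZ.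
    have h1 : hyp i (tau m (y - b *: d0)) by exact: (proj1 (Hm _ Uyb) h).
    have Uk : Uc (tau m d0 - kap *: d0) by apply: UcB; [exact: Uc_tau|exact: UcZ].
    have h2 : hyp i (tau m (y - b *: d0) + b *: (tau m d0 - kap *: d0)).
      by apply: hypD; [exact: Uc_tau|exact: h1|apply: hypZ].
    apply: hyp_ev_equal h2; [|by apply: UcB; [exact: Uc_tau|exact: UcZ]|].
      by apply: UcD; [exact: Uc_tau|exact: UcZ].
    move=> v mv; rewrite !evE; have := tau_lin m b Uyb Ud0 mv; rewrite subrK !evE => e1.
    by rewrite e1; ring.
  have h2 : hyp i (tau (2 * m) d - (c * kap * kap) *: d0).
    have h := step _ _ (Uc_tau m d) (step _ _ Ud hc).
    apply: hyp_ev_equal h; [by apply: UcB; [exact: Uc_tau|exact: UcZ]|by apply: UcB; [exact: Uc_tau|exact: UcZ]|].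
    by move=> v mv; rewrite !evB tau_tau // mul2n -addnn.
  have [c0|c0] := leP 0 c.
    have -> : tau (2 * m) d = (tau (2 * m) d - (c * kap * kap) *: d0) + (c * kap * kap) *: d0.
      by rewrite subrK.
    apply: upD; [by apply: UcB; [exact: Uc_tau|exact: UcZ]|exact: hyp_up|].
    by apply: upZ => //; rewrite -mulrA mulr_ge0 // -expr2 sqr_ge0.
  (* For [c < 0] the coordinate is also nonincreasing along [d], hence constant. *)
  have hd : hyp i d.
    apply: hyp_up_dn => //; apply: up_opp => //.
    have -> : - d = - (d - c *: d0) + (- c) *: d0.
      by rewrite opprB scaleNr addrAC subrr add0r.
    have Udc : Uc (d - c *: d0) by apply: UcB => //; apply: UcZ.
    apply: upD; [exact: UcN|apply: hyp_up; exact: hypN|apply: upZ => //; lra].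
  have h1 : hyp i (tau m d) by exact: (proj1 (Hm _ Ud) hd).
  have h3 : hyp i (tau m (tau m d)) by exact: (proj1 (Hm _ (Uc_tau m d)) h1).
  apply: hyp_up; apply: hyp_ev_equal h3; [exact: Uc_tau|exact: Uc_tau|].
  by move=> v mv; rewrite tau_tau // mul2n -addnn.
have fixed v x : maxi v -> Om x -> ev v x = N x -> ev v (iter (2 * m) f x) = N x.
  move=> mv Ox vx; have Ux := Uc_Om Ox; set y := iter _ f x.
  have Oy : Om y by apply: Om_iter.
  have yE : ev_equal (tau (2 * m) x) y.
    move=> c mc; have [e [me Ho He]] := ev_tau (2 * m) mc; by rewrite He // Ho.
  have tx : top v x by split => // e me; rewrite vx ev_le.
  rewrite -(Om_iterN (2 * m) Ox) -/y ev_sum N_sum; apply: eq_bigr => i _.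
  rewrite -pcoord_Om //; have [Ei|nEi] := pselect (movable i); last first.
    by rewrite (not_movable nEi) ?mulr0 ?normr0 //; apply: Uc_Om.
  have U0 : Uc 0 by move=> e c _ _; rewrite !ev0.
  case sv : (sg v i).
    have : up i (tau (2 * m) (- x)).
      apply: up2 => //; first exact: UcN.
      apply: dn_opp; [exact: UcN|rewrite opprK; exact: top_dn tx Ux sv].
    move=> /(@up_ev_equal _ _ (- y))-/(_ (Uc_tau _ _) (UcN (Uc_Om Oy))) h.
    have /up_opp : up i (- y).
      apply: h => c mc; rewrite evN -yE //.
      have [e [me Ho He]] := ev_tau (2 * m) mc; by rewrite !He ?evN //; apply: UcN.
    move=> /(_ (Uc_Om Oy) 0 U0); rewrite add0r pcoord0 => h0.
    by rewrite expr1 mulN1r ler0_norm.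
  have : up i (tau (2 * m) x) by apply: up2 => //; exact: top_up tx Ux sv.
  move=> /(up_ev_equal (Uc_tau _ _) (Uc_Om Oy) yE) /(_ 0 U0); rewrite add0r pcoord0 => h0.
  by rewrite mul1r ger0_norm.
move=> x Ox; apply: iter_separated => // v mv.
have [e [me _ He]] := equivariance_iter (2 * m) mv; rewrite He //.
apply: agreement => //; apply/clsP => y Oy /= vy; rewrite -He //.
have [v0y|v0y] := leP 0 (ev v y).
  by rewrite ger0_norm // in vy; rewrite fixed.
rewrite ltr0_norm // in vy; have := fixed (neg v) y (maxi_neg mv) Oy.
by rewrite !ev_neg vy => /(_ erefl) h; apply: oppr_inj; rewrite h vy.
Qed.
End SumOfCoordinates.

Lemma order_sum_norm (n : nat) (co : 'I_n -> {scalar X}) (sg : V -> 'I_n -> bool) :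
  (forall v x, ev v x = \sum_i (-1) ^+ sg v i * co i x) ->
  (forall x, N x = \sum_i `|co i x|) ->
  exists pi : 'S_n, forall x, Om x -> N (iter (2 * #[pi]%g) f x - x) = 0.
Proof.
move=> ev_sum N_sum; have [[v mv]|nmax] := pselect (exists v, maxi v).
  exact: (order_sum_of_coordinates ev_sum N_sum mv).
exists 1%g => x Ox; apply: iter_separated => // v mv; by case: nmax; exists v.
Qed.

Lemma iter_fixed k q x : iter q f x = x -> iter (k * q) f x = x.
Proof. by move=> h; elim: k => //= k IH; rewrite mulSn iterD IH. Qed.

(** The [q]-th iterate fixes [P x] and is nonexpansive, so one close approach to [P x] at a multiple
    of [q] persists. *)
Lemma converges q : (0 < q)%N -> (forall x, Om x -> N (iter q f x - x) = 0) ->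
  forall x, exists2 y, iter q f y = y &
    forall eps, 0 < eps -> exists K, forall k, (K <= k)%N -> N (iter (k * q) f x - y) < eps.
Proof.
move=> q0 H x; have Py : iter q f (P x) = P x.
  by apply/eqP; rewrite -subr_eq0; apply/eqP/N_eq0/H.
exists (P x) => // eps e0; have [k0 [_ /dvdnP[c ->] h _]] := P_approx x x e0 q0.
exists c => k ck; rewrite -(subnK ck) mulnDl iterD -[P x in X in N X](iter_fixed (k - c) Py).
by apply: le_lt_trans (iter_f_le _ _ _) _; rewrite N_sub.
Qed.
End Recurrent.

(** * Existence of the periods *)

Definition attracted q := forall x, exists2 y, iter q f y = y &
  forall eps, 0 < eps -> exists K, forall k, (K <= k)%N -> N (iter (k * q) f x - y) < eps.

Section Periods.
Variable U : set_system nat.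
Hypothesis UF : ProperFilter U.
Hypothesis U_infty : forall k, U [set j | (k <= j)%N].
Hypothesis U_limit : forall S : nat -> X, (exists C, forall j, N (S j) <= C) ->
  exists l, forall eps : R, 0 < eps -> U [set j | N (S j - l) < eps].

Lemma attracted_signed_coordinates n (co : 'I_n -> X -> R) (idx : V -> 'I_n) (sg : V -> bool) :
  (forall v x, ev v x = (-1) ^+ sg v * co (idx v) x) ->
  exists pi : 'S_n, attracted (2 * #[pi]%g).
Proof.
move=> ev_co; have [Om [P [HO PA]]] := limit_set UF U_infty U_limit; have [Oz Of Os Oi OP] := HO.
have [pi H] := order_signed_coordinates Oz Of Os Oi OP PA ev_co.
exists pi; have q0 : (0 < 2 * #[pi]%g)%N by rewrite muln_gt0 order_gt0.
by move=> x; apply: (converges OP PA q0).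
Qed.

Lemma attracted_sum_of_coordinates n (co : 'I_n -> {scalar X}) (sg : V -> 'I_n -> bool) :
  (forall v x, ev v x = \sum_i (-1) ^+ sg v i * co i x) ->
  (forall x, N x = \sum_i `|co i x|) ->
  exists pi : 'S_n, attracted (2 * #[pi]%g).
Proof.
move=> ev_sum N_sum; have [Om [P [HO PA]]] := limit_set UF U_infty U_limit; have [Oz Of Os Oi OP] := HO.
have [pi H] := order_sum_norm Oz Of Os Oi OP PA ev_sum N_sum.
exists pi; have q0 : (0 < 2 * #[pi]%g)%N by rewrite muln_gt0 order_gt0.
by move=> x; apply: (converges OP PA q0).
Qed.
End Periods.
End Map.
End Polyhedral.

(** * Analytic functions along lines *)

Lemma cvg_dist_le (R : realType) (u : nat -> R) (l c B : R) (N0 : nat) :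
  u @ \oo --> l -> (forall N, (N0 <= N)%N -> `|u N - c| <= B) -> `|l - c| <= B.
Proof.
move=> /cvgrPdist_lt cv H; apply/ler_addgt0Pr => eps e0.
have [N1 _ hN1] := cv eps e0.
have := hN1 (maxn N0 N1) (leq_maxr _ _); have := H (maxn N0 N1) (leq_maxl _ _).
rewrite /= => h1 h2; apply: le_trans (ler_distD (u (maxn N0 N1)) _ _) _; lra.
Qed.

(* [germ K g]: near [0], [g] is the limit of polynomials [\sum_(m < K N) b N m s^m]
   which are absolutely bounded and whose [m]-th coefficient is independent of
   [N] as soon as [m < N]. The box partial sums of a multivariate power series
   restricted to a line have this form. *)
Definition germ (R : realType) (K : nat -> nat) (g : R -> R) :=
  exists r : R, 0 < r /\ exists b : nat -> nat -> R,
  (forall m N, (m < N)%N -> b N m = b m.+1 m) /\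
  forall s, `|s| < r ->
    (exists M, forall N, \sum_(m < K N) `|b N m * s ^+ m| <= M) /\
    (fun N => \sum_(m < K N) b N m * s ^+ m) @ \oo --> g s.

(** If the coefficients below [m] vanish, [g s] differs from its [m]-th term by a multiple of
    [s ^+ m.+1] with bounded factor, so zeros accumulating at 0 kill the [m]-th coefficient. Once
    all vanish, a geometric sequence tending to 0 bounds [g s]. *)
Lemma germ_zero (R : realType) (K : nat -> nat) (g : R -> R) :
  (forall N, (N <= K N)%N) -> germ K g ->
  (forall e, 0 < e -> exists s, [/\ 0 < `|s|, `|s| < e & g s = 0]) ->
  exists2 e, 0 < e & forall s, `|s| < e -> g s = 0.
Proof.
move=> KN [r [r0 [b [bE H]]]] acc.
pose s0 := r / 2; have s00 : 0 < s0 by rewrite /s0; lra.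
have [|[M HM] _] := H s0; first by rewrite gtr0_norm // /s0; lra.
have M0 : 0 <= M by apply: le_trans (HM 0%N); apply: sumr_ge0.
have bound m s : (forall k, (k < m)%N -> b k.+1 k = 0) -> `|s| <= s0 ->
    `|g s - b m.+1 m * s ^+ m| <= (`|s| / s0) ^+ m.+1 * M.
  move=> bz ss0; set rho := `|s| / s0.
  have rho0 : 0 <= rho by rewrite divr_ge0 // ltW.
  have rho1 : rho <= 1 by rewrite ler_pdivrMr // mul1r.
  have sr : `|s| < r by apply: le_lt_trans ss0 _; rewrite /s0; lra.
  have [_ cv] := H s sr; apply: (cvg_dist_le (N0 := m.+1) cv) => N mN.
  have mK : (m < K N)%N by apply: leq_trans mN (KN N).
  rewrite (bigD1 (Ordinal mK)) //= bE // addrAC subrr add0r.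
  apply: le_trans (ler_norm_sum _ _ _) _.
  apply: le_trans (ler_wpM2l (exprn_ge0 m.+1 rho0) (HM N)).
  rewrite mulr_sumr big_mkcond /=; apply: ler_sum => k _.
  case: ifP => [km|_]; last by rewrite mulr_ge0 // exprn_ge0.
  have [km1|km1|km1] := ltngtP k m.
  - by rewrite bE ?bz ?mul0r ?normr0 ?mulr_ge0 ?exprn_ge0 //; lia.
  - rewrite !normrM !normrX [`|s0|]gtr0_norm // mulrCA ler_wpM2l //.
    have -> : `|s| = rho * s0 by rewrite divfK // gt_eqF.
    rewrite exprMn ler_wpM2r ?exprn_ge0 ?(ltW s00) //.
    by rewrite ler_wiXn2l.
  - by move: km; rewrite -val_eqE /= km1 eqxx.
have bz m : b m.+1 m = 0.
  elim/ltn_ind: m => m IH; apply/eqP; rewrite -normr_le0.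
  apply/ler_addgt0Pr => eps e0; rewrite add0r.
  pose C := M / s0 ^+ m.+1; have C0 : 0 <= C by rewrite divr_ge0 // exprn_ge0 // ltW.
  have [|s [sp se gs]] := acc (Num.min s0 (eps / (C + 1))).
    by rewrite lt_min s00 divr_gt0 //; lra.
  move: se; rewrite lt_min => /andP[ss0]; rewrite ltr_pdivlMr; last by lra.
  move=> se; have := bound m s IH (ltW ss0).
  rewrite gs add0r normrN normrM normrX exprMn exprVn -mulrA mulrC -[_ * M]mulrC.
  rewrite -/C exprSr -mulrA ler_pM2l ?exprn_gt0 // => h.
  apply: le_trans h _; apply: le_trans (ltW se); rewrite ler_wpM2l //; lra.
exists (s0 / 2); first by lra.
move=> s ss; have ss0 : `|s| <= s0 by lra.
have rho0 : 0 <= `|s| / s0 by rewrite divr_ge0 // ltW.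
have rho1 : `|s| / s0 < 1 by rewrite ltr_pdivrMr // mul1r; lra.
have h m : `|g s| <= geometric M (`|s| / s0) m.+1.
  have := bound m s (fun k _ => bz k) ss0.
  by rewrite bz mul0r subr0 /geometric /= mulrC.
have cv : geometric M (`|s| / s0) @ \oo --> 0.
  by apply: cvg_geometric; rewrite ger0_norm.
apply/eqP; rewrite -normr_le0; apply/ler_addgt0Pr => eps e0; rewrite add0r.
have /cvgr0Pnorm_lt/(_ eps e0)[N _ hN] := cv.
apply: le_trans (h N) _; apply: le_trans (ler_norm _) _; apply: ltW.
by apply: hN => /=.
Qed.

(** At the supremum of the [t] such that [g] vanishes on [[a, t]], zeros accumulate from the left,
    and [germ_zero] carries them further to the right. *)
Lemma zero_extension (R : realType) (K : nat -> nat) (g : R -> R) (a b : R) :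
  (forall N, (N <= K N)%N) -> (forall t, germ K (fun s => g (t + s))) ->
  a < b -> (forall t, a <= t <= b -> g t = 0) -> forall t, a <= t -> g t = 0.
Proof.
move=> KN gg ab gz t1 at1; apply: contrapT => gt1.
pose S := [set t | a <= t /\ forall u, a <= u <= t -> g u = 0].
have Sb : S b by split; [exact: ltW|].
have ubS : ubound S t1.
  move=> t [ta ht]; rewrite leNgt; apply/negP => tt1.
  by apply: gt1; apply: ht; rewrite at1 ltW.
have hS : has_sup S by split; [exists b|exists t1].
set T := sup S; have bT : b <= T by apply: ub_le_sup => //; exists t1.
have below u : a <= u -> u < T -> g u = 0.
  move=> au uT; have Tu : 0 < T - u by rewrite subr_gt0.
  have [c [_ hc]] := sup_adherent Tu hS.
  by rewrite opprB addrC subrK => uc; apply: hc; rewrite au ltW.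
have [|e e0 he] := germ_zero KN (gg T).
  move=> e e0; pose d := Num.min (T - a) (e / 2).
  have d0 : 0 < d by rewrite lt_min; apply/andP; split; lra.
  have da : d <= T - a by rewrite ge_min lexx.
  have de : d <= e / 2 by rewrite ge_min lexx orbT.
  exists (- d); rewrite normrN gtr0_norm //; split => //; first by lra.
  by apply: below; lra.
have : S (T + e / 2).
  split; first by lra.
  move=> u /andP[au uT]; have [uT'|uT'] := ltP u T; first exact: below.
  have -> : u = T + (u - T) by rewrite addrC subrK.
  by apply: he; rewrite ger0_norm; lra.
move=> h; have : T + e / 2 <= T by apply: ub_le_sup => //; exists t1.
by rewrite gerDl; lra.
Qed.

Lemma germD (R : realType) (K : nat -> nat) (g h : R -> R) :
  germ K g -> germ K h -> germ K (fun s => g s + h s).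
Proof.
move=> [r [r0 [b [bE H]]]] [r' [r'0 [b' [bE' H']]]].
exists (Num.min r r'); split; first by rewrite lt_min r0.
exists (fun N m => b N m + b' N m); split; first by move=> m N mN; rewrite bE // bE'.
move=> s; rewrite lt_min => /andP[sr sr'].
have [[M HM] cv] := H s sr; have [[M' HM'] cv'] := H' s sr'; split.
  exists (M + M') => N; apply: le_trans (lerD (HM N) (HM' N)).
  by rewrite -big_split; apply: ler_sum => m _ /=; rewrite mulrDl ler_normD.
have -> : (fun N => \sum_(m < K N) (b N m + b' N m) * s ^+ m) =
    (fun N => \sum_(m < K N) b N m * s ^+ m + \sum_(m < K N) b' N m * s ^+ m).
  by apply/funext => N; rewrite -big_split; apply: eq_bigr => m _; rewrite mulrDl.
exact: cvgD.
Qed.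

Lemma germZ (R : realType) (K : nat -> nat) (g : R -> R) (a : R) :
  germ K g -> germ K (fun s => a * g s).
Proof.
move=> [r [r0 [b [bE H]]]]; exists r; split => //.
exists (fun N m => a * b N m); split; first by move=> m N mN; rewrite bE.
move=> s /H[[M HM] cv]; split.
  exists (`|a| * M) => N; apply: le_trans (ler_wpM2l (normr_ge0 a) (HM N)).
  by rewrite mulr_sumr; apply: ler_sum => m _ /=; rewrite -mulrA normrM.
have -> : (fun N => \sum_(m < K N) a * b N m * s ^+ m) =
    (fun N => a * \sum_(m < K N) b N m * s ^+ m).
  by apply/funext => N; rewrite mulr_sumr; apply: eq_bigr => m _; rewrite mulrA.
by apply: cvgM => //; apply: cvg_cst.
Qed.

Lemma germ_affine (R : realType) (K : nat -> nat) (a b : R) :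
  (forall N, (2 <= K N)%N) -> germ K (fun s => a + s * b).
Proof.
move=> K2; exists 1; split => //.
pose c (N m : nat) := if m == 0%N then a else if m == 1%N then b else 0.
exists c; split => // s _.
have E N (F : R -> R) : F 0 = 0 ->
    \sum_(m < K N) F (c N m * s ^+ m) = F a + F (s * b).
  move=> F0; rewrite -(subnKC (K2 N)) addSn addSn add0n !big_ord_recl /= big1.
    by rewrite /c /= expr0 mulr1 expr1 addr0 [b * s]mulrC.
  by move=> i _; rewrite /c /= mul0r.
split; first by exists (`|a| + `|s * b|) => N; rewrite (E N (fun x => `|x|)) ?normr0.
have -> : (fun N => \sum_(m < K N) c N m * s ^+ m) = (fun=> a + s * b).
  by apply/funext => N; rewrite (E N id).
exact: cvg_cst.
Qed.

Lemma germ0 (R : realType) (K : nat -> nat) : germ K (fun _ : R => 0).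
Proof.
exists 1; split => //; exists (fun _ _ => 0); split => // s _.
split; first by exists 0 => N; rewrite big1 // => i _; rewrite mul0r normr0.
have -> : (fun N => \sum_(m < K N) 0 * s ^+ m) = (fun=> (0 : R)).
  by apply/funext => N; rewrite big1 // => i _; rewrite mul0r.
exact: cvg_cst.
Qed.

Lemma germ_sum (R : realType) (K : nat -> nat) (I : Type) (l : seq I) (g : I -> R -> R) :
  (forall i, germ K (g i)) -> germ K (fun s => \sum_(i <- l) g i s).
Proof.
move=> H; elim: l => [|i l IH].
  have -> : (fun s => \sum_(j <- [::]) g j s) = (fun=> 0) by apply/funext => s; rewrite big_nil.
  exact: germ0.
have -> : (fun s => \sum_(j <- i :: l) g j s) = (fun s => g i s + \sum_(j <- l) g j s).
  by apply/funext => s; rewrite big_cons.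
exact: germD.
Qed.

(** A multi-index of total degree [m] has all entries at most [m], so larger boxes contain no others
    of that degree. *)
Lemma box_indep (R : realType) (n m B : nat) (F : ('I_n -> nat) -> R) : (m < B)%N ->
  \sum_(al : {ffun 'I_n -> 'I_B} | (\sum_i al i)%N == m) F (fun i => al i) =
  \sum_(al : {ffun 'I_n -> 'I_m.+1} | (\sum_i al i)%N == m) F (fun i => al i).
Proof.
move=> mB; pose h (al : {ffun 'I_n -> 'I_m.+1}) : {ffun 'I_n -> 'I_B} :=
  [ffun i => widen_ord mB (al i)].
pose h' (be : {ffun 'I_n -> 'I_B}) : {ffun 'I_n -> 'I_m.+1} := [ffun i => inord (be i)].
rewrite (reindex_onto h h') => [|be /eqP bm]; last first.
  apply/ffunP => i; apply: val_inj; rewrite !ffunE /= inordK // ltnS -bm.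
  by rewrite (bigD1 i) //= leq_addr.
apply: eq_big => [al|al _].
  have -> : h' (h al) == al.
    by apply/eqP/ffunP => i; rewrite !ffunE; apply: val_inj; rewrite /= inordK.
  by rewrite andbT; congr (_ == _); apply: eq_bigr => i _; rewrite ffunE.
by congr F; apply/funext => i; rewrite ffunE.
Qed.

(** The box partial sum is regrouped by total degree. The bound [(n.+1 * N).+2] exceeds all degrees
    in the box, and is at least [N] and 2 as [germ_zero] and [germ_affine] require. *)
Lemma analytic_germ (R : realType) (n : nat) (h : ('I_n -> R) -> R) (y d : 'I_n -> R) (t : R) :
  real_analytic_fun h ->
  germ (fun N => (n.+1 * N).+2) (fun s => h (y + (t + s) *: d)).
Proof.
move=> /(_ (y + t *: d))[r [r0 [c H]]].
pose D := \sum_i `|d i| + 1.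
have D0 : 0 < D by rewrite ltr_pwDr // sumr_ge0.
exists (r / D); split; first by rewrite divr_gt0.
pose F (al : 'I_n -> nat) := c al * \prod_i d i ^+ al i.
pose b N m := \sum_(al : {ffun 'I_n -> 'I_N} | (\sum_i al i)%N == m) F (fun i => al i).
exists b; split; first by move=> m N mN; apply: box_indep.
move=> s sr.
have [i|] := H (y + (t + s) *: d).
  have -> : (y + (t + s) *: d) i - (y + t *: d) i = s * d i.
    by rewrite !fctE; rewrite /GRing.scale /=; ring.
  rewrite normrM; move: sr; rewrite ltr_pdivlMr //; apply: le_lt_trans.
  rewrite ler_wpM2l // /D (bigD1 i) //= -addrA lerDl addr_ge0 // sumr_ge0 //.
have E (al : 'I_n -> nat) :
    c al * \prod_i ((y + (t + s) *: d) i - (y + t *: d) i) ^+ al i = F al * s ^+ (\sum_i al i)%N.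
  rewrite /F -mulrA; congr (_ * _); rewrite -prodrXr -big_split /=; apply: eq_bigr => i _.
  rewrite -exprMn; congr (_ ^+ _); rewrite !fctE /GRing.scale /=; ring.
have regroup N (G : ('I_n -> nat) -> R) :
    \sum_(al : {ffun 'I_n -> 'I_N}) G (fun i => al i) =
    \sum_(m < (n.+1 * N).+2) \sum_(al : {ffun 'I_n -> 'I_N} | (\sum_i al i)%N == m) G (fun i => al i).
  rewrite (partition_big (fun al : {ffun 'I_n -> 'I_N} => inord (\sum_i al i)%N : 'I_(n.+1 * N).+2) xpredT) //=.
  apply: eq_bigr => m _; apply: eq_bigl => al.
  have small : (\sum_i al i < (n.+1 * N).+2)%N.
    rewrite ltnS; apply: leqW; apply: (@leq_trans (\sum_(i < n) N)).
      by apply: leq_sum => i _; apply: ltnW.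
    by rewrite sum_nat_const card_ord leq_mul2r leqnSn orbT.
  by rewrite -val_eqE /= inordK.
move=> [M HM] cv; split.
  exists M => N; apply: le_trans (HM N).
  rewrite (regroup N (fun al => `|c al * \prod_i ((y + (t + s) *: d) i - (y + t *: d) i) ^+ al i|)) //.
  apply: ler_sum => m _; rewrite /b mulr_suml; apply: le_trans (ler_norm_sum _ _ _) _.
  by apply: ler_sum => al /eqP alm; rewrite E alm.
have <- : (fun N => \sum_(al : {ffun 'I_n -> 'I_N})
      c (fun i => al i) * \prod_i ((y + (t + s) *: d) i - (y + t *: d) i) ^+ al i) =
    (fun N => \sum_(m < (n.+1 * N).+2) b N m * s ^+ m).
  apply/funext => N.
  rewrite (regroup N (fun al => c al * \prod_i ((y + (t + s) *: d) i - (y + t *: d) i) ^+ al i)) //.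
  apply: eq_bigr => m _; rewrite /b mulr_suml.
  by apply: eq_bigr => al /eqP alm; rewrite E alm.
exact: cv.
Qed.

(** The difference from the affine function vanishes to the right of [a] by [zero_extension];
    reversing [d] handles the left. *)
Lemma analytic_line (R : realType) (n : nat) (f : ('I_n -> R) -> 'I_n -> R)
    (w : 'I_n -> R) (y d : 'I_n -> R) (a b al be : R) :
  real_analytic f -> a < b ->
  (forall t, a <= t <= b -> \sum_i w i * f (y + t *: d) i = al + t * be) ->
  forall t, \sum_i w i * f (y + t *: d) i = al + t * be.
Proof.
move=> fa.
have right e a' b' be' : a' < b' ->
    (forall t, a' <= t <= b' -> \sum_i w i * f (y + t *: e) i = al + t * be') ->
    forall t, a' <= t -> \sum_i w i * f (y + t *: e) i = al + t * be'.
  move=> ab H t at_; apply/eqP; rewrite -subr_eq0; apply/eqP.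
  pose g t := \sum_i w i * f (y + t *: e) i + - 1 * (al + t * be').
  have -> : \sum_i w i * f (y + t *: e) i - (al + t * be') = g t by rewrite /g mulN1r.
  apply: (@zero_extension R (fun N => (n.+1 * N).+2) g a' b') => //.
  - by move=> N; do 2!apply: leqW; rewrite leq_pmull.
  - move=> u; apply: germD.
      by apply: germ_sum => i; apply: germZ; exact: (analytic_germ y e u (fa i)).
    apply: germZ; have -> : (fun s => al + (u + s) * be') = (fun s => (al + u * be') + s * be').
      by apply/funext => s; rewrite mulrDl addrA.
    exact: germ_affine.
  - by move=> u hu; rewrite /g H // mulN1r subrr.
move=> ab H t; have [ta|ta] := leP a t; first exact: right H t ta.
have neg u : u *: - d = (- u) *: d by rewrite scalerN scaleNr.
have := @right (- d) (- b) (- a) (- be); rewrite ltrN2 => /(_ ab) h.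
rewrite -[t]opprK -neg h; [by rewrite mulrNN opprK| |by lra].
by move=> u hu; rewrite neg mulrN -mulNr; apply: H; apply/andP; split; lra.
Qed.

(** * Norms of coordinate vectors *)

Section Coordinates.
Variables (R : realType) (n : nat).
Notation X := ('I_n -> R).

Definition coord (i : 'I_n) (x : X) : R := x i.

Lemma coord_is_linear i : scalar (coord i).
Proof. by move=> a x y. Qed.
HB.instance Definition _ i :=
  GRing.isLinear.Build R X R *%R (coord i) (coord_is_linear i).

Definition signed_coord (v : 'I_n * bool) (x : X) : R := (-1) ^+ v.2 * x v.1.

Lemma signed_coord_is_linear v : scalar (signed_coord v).
Proof. by move=> a x y; rewrite /signed_coord !fctE mulrDr /GRing.scale /= mulrCA. Qed.
HB.instance Definition _ v :=
  GRing.isLinear.Build R X R *%R (signed_coord v) (signed_coord_is_linear v).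

Definition signed_sum (v : {ffun 'I_n -> bool}) (x : X) : R := \sum_i (-1) ^+ v i * x i.

Lemma signed_sum_is_linear v : scalar (signed_sum v).
Proof.
move=> a x y; rewrite /signed_sum mulr_sumr -big_split /=; apply: eq_bigr => i _.
by rewrite !fctE mulrDr /GRing.scale /= mulrCA.
Qed.
HB.instance Definition _ v :=
  GRing.isLinear.Build R X R *%R (signed_sum v) (signed_sum_is_linear v).

Lemma sign_mul_le (b : bool) (x : R) : (-1) ^+ b * x <= `|x|.
Proof. by apply: le_trans (ler_norm _) _; rewrite normrM normrX normrN1 expr1n mul1r. Qed.

Lemma sign_mul_attain (x : R) : (-1) ^+ (x < 0)%R * x = `|x|.
Proof.
by case: ltP => h /=; [rewrite expr1 mulN1r ltr0_norm|rewrite expr0 mul1r ger0_norm].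
Qed.

Lemma signed_sum_le v (x : X) : signed_sum v x <= Defs.norm1 x.
Proof. by apply: ler_sum => i _; apply: sign_mul_le. Qed.

Lemma signed_sum_attain (x : X) : exists v, signed_sum v x = Defs.norm1 x.
Proof.
exists [ffun i => x i < 0]; apply: eq_bigr => i _; rewrite ffunE; exact: sign_mul_attain.
Qed.

Lemma signed_sum_neg (v : {ffun 'I_n -> bool}) (x : X) :
  signed_sum [ffun i => ~~ v i] x = - signed_sum v x.
Proof.
rewrite /signed_sum -sumrN; apply: eq_bigr => i _; rewrite ffunE signrN mulNr //.
Qed.

Lemma norminf_ge (x : X) i : `|x i| <= norminf x.
Proof. exact: le_bigmax. Qed.

Lemma signed_coord_le v (x : X) : signed_coord v x <= norminf x.
Proof. exact: le_trans (sign_mul_le _ _) (norminf_ge _ _). Qed.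

Lemma signed_coord_attain (x : X) : (0 < n)%N -> exists v, signed_coord v x = norminf x.
Proof.
move=> n0; have i0 : 'I_n by exact: (Ordinal n0).
case: (@arg_maxP _ _ _ i0 xpredT (fun i => `|x i|) isT) => i _ imax.
exists (i, x i < 0); rewrite /signed_coord /= sign_mul_attain.
apply/eqP; rewrite eq_le norminf_ge /=; apply: bigmax_le => // j _; exact: imax.
Qed.

Lemma signed_coord_neg v (x : X) : signed_coord (v.1, ~~ v.2) x = - signed_coord v x.
Proof. by rewrite /signed_coord /= signrN mulNr. Qed.

Lemma norm1_ge (x : X) i : `|x i| <= Defs.norm1 x.
Proof. by rewrite /Defs.norm1 (bigD1 i) //= lerDl sumr_ge0. Qed.

Lemma norminf_le1 (x : X) : norminf x <= Defs.norm1 x.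
Proof. by apply: bigmax_le => [|i _]; [rewrite sumr_ge0|apply: norm1_ge]. Qed.

Lemma pnormv_ge p (x : X) i : `|x i| <= pnormv p x.
Proof. by case: p; [apply: norm1_ge|apply: norminf_ge]. Qed.

Lemma pnormv_le1 p (x : X) : pnormv p x <= Defs.norm1 x.
Proof. by case: p => //; apply: norminf_le1. Qed.

Lemma pnormv_eq0 p (x : X) : pnormv p x = 0 -> x = 0.
Proof.
move=> h; apply/funext => i; apply/eqP; rewrite -normr_le0 -h; exact: pnormv_ge.
Qed.

Lemma pnormv_limit p (U : set_system nat) (S : nat -> X) : UltraFilter U ->
  (exists C, forall j, pnormv p (S j) <= C) ->
  exists l, forall eps, 0 < eps -> U [set j | pnormv p (S j - l) < eps].
Proof.
move=> UU [C SC].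
have /choice[l lP] : forall i, exists l, forall eps, 0 < eps -> U [set j | `|S j i - l| < eps].
  move=> i; apply: (ultra_limit (C := C)) => j; exact: le_trans (pnormv_ge p _ i) (SC j).
exists l => eps e0; pose e := eps / n.+1%:R.
have ep : 0 < e by rewrite divr_gt0.
have : U [set j | forall i, `|S j i - l i| < e].
  apply: (@filter_forall _ _ (fun i => [set j | `|S j i - l i| < e]) U) => i; exact: lP.
apply: filterS => j /= h; apply: le_lt_trans (pnormv_le1 _ _) _.
apply: (@le_lt_trans _ _ (\sum_(i < n) e)); first by apply: ler_sum => i _; exact/ltW/h.
rewrite sumr_const card_ord /e -mulrnAr -[X in _ < X]mulr1 ltr_pM2l //.
by rewrite -mulr_natl ltr_pdivrMr // mul1r ltr_nat.
Qed.

Lemma ultra_nat : exists2 U : set_system nat, UltraFilter U & forall k, U [set j | (k <= j)%N].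
Proof.
have [U [UU sub]] := @ultraFilterLemma nat \oo _; exists U => // k.
by apply: sub; exists k.
Qed.

Lemma pnormv_attracted p (f : X -> X) : (0 < n)%N ->
  f 0 = 0 -> (forall x y, pnormv p (f x - f y) <= pnormv p (x - y)) ->
  (forall (w : 'I_n -> R) (y d : X) (a b al be : R), a < b ->
    (forall t, a <= t <= b -> \sum_i w i * f (y + t *: d) i = al + t * be) ->
    forall t, \sum_i w i * f (y + t *: d) i = al + t * be) ->
  exists pi : 'S_n, attracted (pnormv p) f (2 * #[pi]%g).
Proof.
move=> n0 f0 fN line; have [U UU Uinf] := ultra_nat.
have lim p' S := @pnormv_limit p' U S UU.
case: p fN => fN.
- apply: (@attracted_sum_of_coordinates R X {ffun 'I_n -> bool} signed_sum
    (fun v : {ffun 'I_n -> bool} => [ffun i => ~~ v i]) Defs.norm1 _ _ _ f f0 fN _ _ U _ Uinf _ n coord (fun v i => v i)) => //.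
  + exact: signed_sum_le.
  + exact: signed_sum_attain.
  + exact: signed_sum_neg.
  + by move=> v; apply: (line (fun i => (-1) ^+ v i)).
  + exact: (@pnormv_eq0 P1).
  + exact: (lim P1).
- apply: (@attracted_signed_coordinates R X ('I_n * bool)%type signed_coord
    (fun v => (v.1, ~~ v.2)) norminf _ _ _ f f0 fN _ _ U _ Uinf _ n coord fst snd) => //.
  + exact: signed_coord_le.
  + by move=> x; apply: signed_coord_attain.
  + exact: signed_coord_neg.
  + move=> v y d a b al be ab H t.
    (* A signed coordinate is a weighted sum with a single nonzero weight, the form that [line]
       treats. *)
    have E x : signed_coord v x = \sum_i (if i == v.1 then (-1) ^+ v.2 else 0) * x i.
      by rewrite (bigD1 v.1) //= eqxx big1 ?addr0 // => i /negPf ->; rewrite mul0r.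
    rewrite [LHS](E (f (y + t *: d))); apply: (line _ y d a b) => // u hu.
    by rewrite -E; apply: H.
  + exact: (@pnormv_eq0 Pinf).
  + exact: (lim Pinf).
Qed.
End Coordinates.

(** * Minimal periods and the conclusion *)

Lemma min_period (T : Type) (f : T -> T) (y : T) (q : nat) :
  (0 < q)%N -> iter q f y = y -> exists m, periodic_with_min_period f y m /\ (m %| q)%N.
Proof.
move=> q0 fq; pose Q m := (0 < m)%N && `[< iter m f y = y >].
have exQ : exists m, Q m by exists q; rewrite /Q q0; apply/asboolP.
case: (ex_minnP exQ) => m /andP[m0 /asboolP fm] mmin.
have small k : (0 < k < m)%N -> iter k f y <> y.
  move=> /andP[k0 km] h; have := mmin k; rewrite /Q k0 /= => /(_ _)/leq_gtF.
  by rewrite km => /(_ (asboolT h)).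
have mult k : iter (k * m) f y = y by elim: k => //= k IH; rewrite mulSn iterD IH.
have modm k : iter k f y = iter (k %% m) f y.
  by rewrite {1}(divn_eq k m) addnC iterD mult.
exists m; split; last first.
  rewrite /dvdn; case: (posnP (q %% m)) => [//|qm].
  have /small : (0 < q %% m < m)%N by rewrite qm ltn_mod.
  by rewrite -modm fq.
rewrite /periodic_with_min_period; have -> : orbit_set f y = [set iter k f y | k in `I_m].
  apply/seteqP; split => x /=; last by move=> [k _ <-]; exists k.
  by move=> [k _ <-]; exists (k %% m)%N; rewrite /= ?ltn_mod // -modm.
have inj i j : (i < j)%N -> (j < m)%N -> iter i f y <> iter j f y.
  move=> ij jm h; apply: (small (m - j + i)%N); first by lia.
  by rewrite iterD h -iterD subnK // ltnW.
apply: inj_card_eq => i j /set_mem /= im /set_mem /= jm h.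
by have [ij|ij|//] := ltngtP i j; [case: (inj i j)|case: (inj j i)].
Qed.

Theorem theorem3p1 (R : realType) (n : nat) (p : pnorm)
  (f : ('I_n -> R) -> ('I_n -> R)) :
  real_analytic f -> nonexpansive p f -> (exists x0, f x0 = x0) ->
  exists q : nat, (0 < q)%N /\
    (forall x : 'I_n -> R, exists y : 'I_n -> R,
       (forall i : 'I_n, (fun k : nat => iter (k * q) f x i) @ \oo --> (y i : R)) /\
       exists m : nat, periodic_with_min_period f y m /\ (m %| q)%N) /\
    (exists pi : 'S_n, q = #[pi]%g \/ q = (2 * #[pi]%g)%N).
Proof.
move=> fa fN [x0 fx0].
(* Without coordinates no signed coordinate exists to attain the sup norm; the space is then a
   single point. *)
case: (posnP n) => [n0|n_gt0].
  have no_i (i : 'I_n) : False by have := leq_ltn_trans (leq0n i) (ltn_ord i); rewrite n0.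
  have all0 (x y : 'I_n -> R) : x = y by apply/funext => i; case: (no_i i).
  exists 1%N; split => //; split; last by exists 1%g; left; rewrite order1.
  move=> x; exists x; split; first by move=> i; case: (no_i i).
  exact: min_period.
(* Conjugation by a translation changes weighted sums of coordinates by a constant only, which is
   absorbed into [al]. *)
pose g x := f (x + x0) - x0.
have itg k x : iter k g x = iter k f (x + x0) - x0.
  by elim: k => [|k IH] /=; rewrite ?addrK // IH /g subrK.
have [|x y|w y d a b al be ab Hab t|pi H] := @pnormv_attracted R n p g n_gt0.
- by rewrite /g add0r fx0 subrr.
- have -> : g x - g y = f (x + x0) - f (y + x0) by rewrite /g opprB addrA subrK.
  have -> : x - y = (x + x0) - (y + x0) by rewrite opprD addrACA subrr addr0.
  exact: fN.
- have gE u : \sum_i w i * g (y + u *: d) i =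
      \sum_i w i * f ((y + x0) + u *: d) i - \sum_i w i * x0 i.
    by rewrite -sumrB; apply: eq_bigr => i _; rewrite -mulrBr /g addrAC.
  rewrite gE (analytic_line (al := al + \sum_i w i * x0 i) fa ab (y := y + x0) (be := be)).
    by rewrite addrAC addrK.
  by move=> u /Hab; rewrite gE => /eqP; rewrite subr_eq => /eqP ->; rewrite addrAC.
exists (2 * #[pi]%g)%N; split; first by rewrite muln_gt0 order_gt0.
split; last by exists pi; right.
move=> x; have [y gy cv] := H (x - x0); exists (y + x0); split.
  move=> i; apply/cvgrPdist_lt => eps e0; have [K hK] := cv eps e0.
  exists K => // k /= /hK; apply: le_lt_trans.
  rewrite itg subrK distrC -[X in pnormv _ X]/(_ : 'I_n -> R).
  apply: le_trans (pnormv_ge p _ i); rewrite !fctE /=.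
  by rewrite opprD addrAC addrA.
apply: min_period; first by rewrite muln_gt0 order_gt0.
by rewrite -[LHS](subrK x0) -itg gy.
Qed.
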